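(* Let $\alpha\in[0,1/2)$ and $K>0$ be arbitrary and let $k\ge3$ be an integer. There exist constants $C=C(k,K)>0$, $c_K>0$ depending only on $K$, and $c_4=c_4(k,\alpha,K)>0$ such that the following holds. Let $\delta>0$ and let $x\in\mathbb{R}^N$ be a fixed $k$-sparse vector with support $T=\mathrm{supp}(x)$, $\#T=k$, such that $\min_{j\in T}|x_j|\ge C\delta$. Suppose that $\Phi\in\mathbb{R}^{m\times N}$ is a random matrix whose entries are i.i.d. sub-Gaussian with mean zero, variance one and sub-Gaussian norm not exceeding $K$, and that $\lambda=m/k\ge c_4\log N$. Let $x_{\rm MSQ}$ be obtained from $q=Q(\Phi x)$ using the two-stage method. Then there are constants $c_5,c_6,c_7>0$ that depend only on $k$, $K$ and $x$ such that, with probability at least $1-c_5\exp(-c_6\lambda^\alpha)$ on the draw of $\Phi$, the reconstruction error satisfies $$\|x_{\rm MSQ}-x\|\le A\left(\frac1m\big\|\mathbb{E}E^T(Ex_T-Q(Ex_T))\big\|+c_7\sqrt{\log k}\,\lambda^{-(1-\alpha)/2}\delta\right),$$ where $A=(1/2-c_K\lambda^{-1/2})^{-2}$ and $E=\Phi_T\in\mathbb{R}^{m\times k}$ (whose entries are i.i.d. sub-Gaussian, being copies of the entries of $\Phi$).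
   Context: $\|\cdot\|$ is the Euclidean norm. For $\delta>0$, the uniform scalar quantizer $q_\delta:\mathbb{R}\to\delta\mathbb{Z}$ is $q_\delta(t)=n\delta$ if $t\in(n\delta-\delta/2,\,n\delta+\delta/2]$, $n\in\mathbb{Z}$; $Q=Q_\delta^{\rm MSQ}:\mathbb{R}^m\to(\delta\mathbb{Z})^m$ applies $q_\delta$ to each coordinate. A vector is $k$-sparse if it has at most $k$ nonzero entries. For $T\subset\{1,\dots,N\}$, $x_T\in\mathbb{R}^{\#T}$ is the restriction of $x$ to $T$ and $\Phi_T$ is the submatrix of $\Phi$ consisting of the columns indexed by $T$. $M^\dagger$ is the Moore–Penrose pseudoinverse of $M$. The sub-Gaussian norm of a real random variable $z$ is $\|z\|_{\psi_2}=\sup_{p\ge1}p^{-1/2}(\mathbb{E}|z|^p)^{1/p}$. Two-stage method: given $q=Q(\Phi x)$. Stage 1: let $x^\#$ be a solution of: minimize $\|z\|_1$ over $z\in\mathbb{R}^N$ subject to $\|\Phi z-q\|\le\sqrt m\,\delta/2$; let $\widehat T$ be the set of indices of the $k$ largest-in-magnitude entries of $x^\#$. Stage 2: $x_{\rm MSQ}$ is the vector supported on $\widehat T$ whose restriction to $\widehat T$ is $\Phi_{\widehat T}^\dagger q$. *)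

(* Defs.v *)
From HB Require Import structures.
From mathcomp Require Import all_boot all_order all_algebra.
From mathcomp Require Import all_classical all_reals all_analysis.
From mathcomp Require Import lra.

Set Implicit Arguments.
Unset Strict Implicit.
Unset Printing Implicit Defensive.

Import Order.TTheory GRing.Theory Num.Theory.
Import numFieldNormedType.Exports.

Local Open Scope classical_set_scope.
Local Open Scope ring_scope.

Section vectors.
Context {R : realType}.

(* The library norm on matrices is the maximum norm, so the Euclidean and
   l^1 norms are defined here. *)
Definition norm2 n (v : 'cV[R]_n) : R := Num.sqrt (\sum_i v i 0 ^+ 2).

Definition norm1 n (v : 'cV[R]_n) : R := \sum_i `|v i 0|.

Definition supp n (x : 'cV[R]_n) : {set 'I_n} := [set i | x i 0 != 0]%SET.

(* x_S and M_S; the indices in S are listed by [enum_val]. *)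
Definition subentries n (S : {set 'I_n}) (x : 'cV[R]_n) : 'cV[R]_#|S| :=
  rowsub (fun i : 'I_#|S| => enum_val i) x.

Definition subcols m n (S : {set 'I_n}) (M : 'M[R]_(m, n)) : 'M[R]_(m, #|S|) :=
  colsub (fun i : 'I_#|S| => enum_val i) M.

End vectors.

Section pseudoinverse.
Context {R : realType}.

(* The four Penrose conditions. MathComp's [pinvmx] only satisfies the first
   one in general. *)
Definition penrose m n (M : 'M[R]_(m, n)) (B : 'M[R]_(n, m)) : Prop :=
  [/\ M *m B *m M = M, B *m M *m B = B,
      (M *m B)^T = M *m B & (B *m M)^T = B *m M].

Definition mpinv m n (M : 'M[R]_(m, n)) : 'M[R]_(n, m) :=
  xget 0 [set B | penrose M B].

Lemma penrose_uniq m n (M : 'M[R]_(m, n)) B C :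
  penrose M B -> penrose M C -> B = C.
Proof.
move=> [B1 B2 B3 B4] [C1 C2 C3 C4].
have MBC : M *m B = M *m C.
  have e : M *m B *m (M *m C) = M *m C by rewrite mulmxA B1.
  by rewrite -[RHS]C3 -{}e trmx_mul B3 C3 mulmxA C1.
have BCM : B *m M = C *m M.
  have e : C *m M *m (B *m M) = C *m M by rewrite -mulmxA (mulmxA M) B1.
  by rewrite -[RHS]C4 -{}e trmx_mul B4 C4 -mulmxA (mulmxA M) C1.
by rewrite -B2 BCM -mulmxA MBC mulmxA C2.
Qed.

Let gram_unit m n (M : 'M[R]_(m, n)) : row_free M -> M *m M^T \in unitmx.
Proof.
move=> fM; rewrite -row_free_unit -kermx_eq0; apply/eqP/row_matrixP => i.
rewrite row0; set u := row i _.
have u0 : u *m M *m M^T = 0.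
  by rewrite -mulmxA; apply/sub_kermxP; exact: row_sub.
suff uM0 : u *m M = 0.
  by apply: (row_free_inj fM); rewrite /= mul0mx.
have sq0 : \sum_j (u *m M) 0 j ^+ 2 = 0.
  transitivity ((u *m M *m (u *m M)^T) 0 0).
    by rewrite [RHS]mxE; apply: eq_bigr => j _; rewrite [_^T _ _]mxE -expr2.
  by rewrite trmx_mul mulmxA u0 mul0mx mxE.
apply/rowP => j; rewrite [RHS]mxE; apply/eqP; rewrite -sqrf_eq0.
move/eqP: sq0; rewrite psumr_eq0 => [/allP/(_ j)|l _]; last exact: sqr_ge0.
by rewrite mem_index_enum => /(_ isT).
Qed.

Let penrose_rank_factor m n r (G : 'M[R]_(m, r)) (F : 'M[R]_(r, n)) :
  row_free G^T -> row_free F ->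
  penrose (G *m F)
    (F^T *m invmx (F *m F^T) *m (invmx (G^T *m G) *m G^T)).
Proof.
move=> /gram_unit; rewrite trmxK => uG /gram_unit uF.
have sF : (F *m F^T)^T = F *m F^T by rewrite trmx_mul trmxK.
have sG : (G^T *m G)^T = G^T *m G by rewrite trmx_mul trmxK.
set B := (X in penrose _ X).
have MB : G *m F *m B = G *m (invmx (G^T *m G) *m G^T).
  by rewrite /B !mulmxA -(mulmxA G F) -(mulmxA G) mulmxV// mulmx1.
have BM : B *m (G *m F) = F^T *m invmx (F *m F^T) *m F.
  rewrite /B -!mulmxA (mulmxA G^T) (mulmxA (invmx (G^T *m G))) mulVmx//.
  by rewrite mul1mx.
split.
- rewrite MB -!mulmxA (mulmxA G^T) (mulmxA (invmx (G^T *m G))) mulVmx//.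
  by rewrite mul1mx.
- rewrite BM /B -!mulmxA (mulmxA F F^T) (mulmxA (F *m F^T)) mulmxV//.
  by rewrite mul1mx.
- by rewrite MB !trmx_mul trmxK trmx_inv sG mulmxA.
- by rewrite BM !trmx_mul trmxK trmx_inv sF mulmxA.
Qed.

Lemma mpinvP m n (M : 'M[R]_(m, n)) : penrose M (mpinv M).
Proof.
suff [B BP] : exists B, penrose M B.
  by rewrite /mpinv; case: xgetP => [C _ //|/(_ B)].
rewrite -[M]mulmx_base; eexists; apply: penrose_rank_factor.
  by rewrite /row_free mxrank_tr; exact: col_base_full.
exact: row_base_free.
Qed.

End pseudoinverse.

Section quantizer.
Context {R : realType}.

Definition quantizer (delta t : R) : R :=
  (Num.ceil (t / delta - 2^-1))%:~R * delta.

Lemma quantizerE (delta t : R) (n : int) : 0 < delta ->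
  n%:~R * delta - delta / 2 < t <= n%:~R * delta + delta / 2 ->
  quantizer delta t = n%:~R * delta.
Proof.
move=> d0 /andP[lo hi]; congr (_%:~R * _); apply: ceil_def.
rewrite lerBlDr ltrBrDr ler_pdivrMr// ltr_pdivlMr// intrB mulr1z.
by apply/andP; split; lra.
Qed.

Definition msq (delta : R) m (v : 'cV[R]_m) : 'cV[R]_m := map_mx (quantizer delta) v.

End quantizer.

Section two_stage.
Context {R : realType}.

Definition l1_solution m n (Phi : 'M[R]_(m, n)) (q : 'cV[R]_m) (eta : R)
    (z : 'cV[R]_n) : Prop :=
  norm2 (Phi *m z - q) <= eta /\
  forall y : 'cV[R]_n, norm2 (Phi *m y - q) <= eta -> norm1 z <= norm1 y.

(* Ties in magnitude may be broken in any way. *)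
Definition largest_entries n (k : nat) (z : 'cV[R]_n) (S : {set 'I_n}) : Prop :=
  #|S| = k /\ forall i j, i \in S -> j \notin S -> `|z j 0| <= `|z i 0|.

Definition two_stage m n (delta : R) (k : nat) (Phi : 'M[R]_(m, n))
    (q : 'cV[R]_m) (y : 'cV[R]_n) : Prop :=
  exists (z : 'cV[R]_n) (S : {set 'I_n}),
    [/\ l1_solution Phi q (Num.sqrt m%:R * delta / 2) z,
        largest_entries k z S,
        supp y \subset S &
        subentries S y = mpinv (subcols S Phi) *m q].

End two_stage.

Section probability.
Context d (T : measurableType d) (R : realType) (P : probability T R).

Definition mutually_independent (I : finType) (X : I -> {RV P >-> R}) : Prop :=
  forall (J : {set I}) (B : I -> set R), (forall i, measurable (B i)) ->
    P (\bigcap_(i in [set` J]) X i @^-1` B i) =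
    (\prod_(i in J) P (X i @^-1` B i))%E.

Definition identically_distributed (I : finType) (X : I -> {RV P >-> R}) : Prop :=
  forall (i j : I) (B : set R), measurable B ->
    distribution P (X i) B = distribution P (X j) B.

Definition subgaussian_norm (X : {RV P >-> R}) : \bar R :=
  ereal_sup [set ((p `^ (- 2^-1))%:E * 'N[P]_(p%:E)[EFin \o X])%E
            | p in [set p : R | 1 <= p]].

Definition random_matrix m n (X : 'I_m * 'I_n -> {RV P >-> R}) (w : T) :
    'M[R]_(m, n) :=
  \matrix_(i, j) X (i, j) w.

Definition expectation_cV n (V : T -> 'cV[R]_n) : 'cV[R]_n :=
  \col_i fine 'E_P[fun w => V w i 0].

End probability.

(* Main.v *)
Require Import Defs.
From HB Require Import structures.
From mathcomp Require Import all_boot all_order all_algebra.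
From mathcomp Require Import all_classical all_reals all_analysis.
From mathcomp Require Import measurable_realfun ring lra.

(** The constants [c5], [c6], [c7] may depend on [N], so no restricted isometry
    property is needed: by Bernstein's inequality and a union bound over the
    [N ^ 2] pairs of columns, [Phi^T Phi / m] is entrywise within [1 / (8 k)] of
    the identity, which already bounds [|Phi h|^2] from below by [m |h|^2 / 2]
    on the cone [|h_{T^c}|_1 <= |h_T|_1]. This cone contains [x^# - x], whence
    [|x^# - x| <= sqrt 2 delta] and the recovery of the support, and it contains
    [x_MSQ - x], for which the normal equations give
    [|x_MSQ - x| <= (2 / m) |E^T (E x_T - Q (E x_T))|]. The latter vector is a
    sum of independent products of a sub-Gaussian entry with a bounded
    quantization error, so the same Bernstein inequality controls its deviation
    from the mean at scale [lambda ^ (- (1 - alpha) / 2) delta]. Since [A >= 4]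
    as soon as [lambda >= 16], one can take [cK = 1] and [C = 3]. *)

Set Implicit Arguments.
Unset Strict Implicit.
Unset Printing Implicit Defensive.

Import Order.TTheory GRing.Theory Num.Theory.
Import numFieldNormedType.Exports.

Local Open Scope classical_set_scope.
Local Open Scope ring_scope.

(** * Coherence and the two-stage method *)

(** The sum of the squares [(B * a i - D * b i) ^+ 2] expands to [B * (A * B - D ^+ 2)]. Dividing by
    [B] requires [B > 0]; if [B = 0], every [b i] vanishes and so does [D]. *)
Lemma cauchy_schwarz_sum (R : realFieldType) (I : finType) (P : pred I)
    (a b : I -> R) :
  (\sum_(i | P i) a i * b i) ^+ 2 <=
  (\sum_(i | P i) a i ^+ 2) * (\sum_(i | P i) b i ^+ 2).
Proof.
set A := \sum_(i | P i) a i ^+ 2; set B := \sum_(i | P i) b i ^+ 2.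
set D := \sum_(i | P i) a i * b i.
have B0 : 0 <= B by apply: sumr_ge0 => i _; exact: sqr_ge0.
have : 0 <= B * (A * B - D ^+ 2).
  have -> : B * (A * B - D ^+ 2) = \sum_(i | P i) (B * a i - D * b i) ^+ 2.
    transitivity (\sum_(i | P i)
        (B ^+ 2 * a i ^+ 2 - 2 * B * D * (a i * b i) + D ^+ 2 * b i ^+ 2)).
      by rewrite big_split /= sumrB -!mulr_sumr -/A -/B -/D; ring.
    by apply: eq_bigr => i _; ring.
  by apply: sumr_ge0 => i _; exact: sqr_ge0.
move: B0; rewrite le_eqVlt => /predU1P[B0 _|B0]; last first.
  by rewrite pmulr_rge0// subr_ge0.
suff -> : D = 0 by rewrite -B0 expr0n /= mulr0.
apply: big1 => i Pi; suff -> : b i = 0 by rewrite mulr0.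
apply/eqP; rewrite -sqrf_eq0; move/esym/eqP: B0.
rewrite psumr_eq0 => [/allP/(_ i)|j _]; last exact: sqr_ge0.
by rewrite mem_index_enum Pi => /(_ isT).
Qed.

Lemma sqr_sum_le_card (R : realFieldType) (I : finType) (T : {set I})
    (a : I -> R) :
  (\sum_(i in T) a i) ^+ 2 <= #|T|%:R * \sum_(i in T) a i ^+ 2.
Proof.
have := cauchy_schwarz_sum (mem T) (fun=> 1) a.
under eq_bigr do rewrite mul1r.
move=> /le_trans; apply.
by rewrite expr1n sumr_const.
Qed.

Section euclidean_norm.
Context {R : realType}.

Lemma norm2_ge0 n (v : 'cV[R]_n) : 0 <= norm2 v.
Proof. exact: sqrtr_ge0. Qed.

Lemma norm2_sqr n (v : 'cV[R]_n) : norm2 v ^+ 2 = \sum_i v i 0 ^+ 2.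
Proof. by rewrite sqr_sqrtr// sumr_ge0// => i _; exact: sqr_ge0. Qed.

Lemma norm2_le n (v : 'cV[R]_n) (c : R) : 0 <= c ->
  \sum_i v i 0 ^+ 2 <= c ^+ 2 -> norm2 v <= c.
Proof.
by move=> c0; rewrite -norm2_sqr ler_pXn2r// nnegrE ?norm2_ge0.
Qed.

Lemma norm2N n (v : 'cV[R]_n) : norm2 (- v) = norm2 v.
Proof.
by rewrite /norm2; congr Num.sqrt; apply: eq_bigr => i _; rewrite mxE sqrrN.
Qed.

Lemma norm2D n (u v : 'cV[R]_n) : norm2 (u + v) <= norm2 u + norm2 v.
Proof.
apply: norm2_le; first by rewrite addr_ge0 ?norm2_ge0.
rewrite sqrrD !norm2_sqr.
under eq_bigr do rewrite mxE sqrrD.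
rewrite 2!big_split /= lerD2r lerD2l sumrMnl lerMn2r /=.
apply: le_trans (ler_norm _) _.
rewrite -ler_sqr ?nnegrE ?mulr_ge0 ?norm2_ge0//.
by rewrite real_normK ?num_real// exprMn !norm2_sqr cauchy_schwarz_sum.
Qed.

Lemma norm2_le_card n (v : 'cV[R]_n) (c : R) : 0 <= c ->
  (forall i, `|v i 0| <= c) -> norm2 v <= Num.sqrt n%:R * c.
Proof.
move=> c0 vc; apply: norm2_le; first by rewrite mulr_ge0 ?sqrtr_ge0.
rewrite exprMn sqr_sqrtr ?ler0n//.
have -> : n%:R * c ^+ 2 = \sum_(i < n) c ^+ 2.
  by rewrite sumr_const card_ord mulr_natl.
apply: ler_sum => i _.
by rewrite -[_ ^+ 2]real_normK ?num_real// ler_pXn2r ?nnegrE.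
Qed.

Lemma norm2_subentries_sqr n (S : {set 'I_n}) (v : 'cV[R]_n) :
  norm2 (subentries S v) ^+ 2 = \sum_(i in S) v i 0 ^+ 2.
Proof.
rewrite norm2_sqr [RHS]big_enum_val /=.
by apply: eq_bigr => i _; rewrite mxE.
Qed.

Lemma mulmx_subcols m n (S : {set 'I_n}) (M : 'M[R]_(m, n)) (v : 'cV[R]_n) :
  supp v \subset S -> subcols S M *m subentries S v = M *m v.
Proof.
move=> /fintype.subsetP vS; apply/colP => i; rewrite !mxE.
rewrite (bigID (mem S)) /= [X in _ = _ + X]big1 ?addr0; last first.
  move=> j jS; apply/eqP; rewrite mulf_eq0; apply/orP; right.
  by apply: contraNT jS => vj; apply: vS; rewrite inE.
rewrite [RHS]big_enum_val /=; apply: eq_bigr => j _; rewrite !mxE.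
by [].
Qed.

End euclidean_norm.

Section coherence.
Context {R : realType}.

Definition gram m n (M : 'M[R]_(m, n)) (j l : 'I_n) : R :=
  \sum_i M i j * M i l.

(* Small off-diagonal Gram entries replace the restricted isometry property:
   on the cone of vectors concentrated on [k] entries they already give a lower
   bound, since [|h|_1 <= 2 sqrt k |h|_2] there. *)
Lemma gram_lower_bound m n (M : 'M[R]_(m, n)) (T : {set 'I_n}) (h : 'cV[R]_n) :
  (0 < #|T|)%N ->
  (forall j l, `|gram M j l - m%:R * (j == l)%:R| <= m%:R / (8 * #|T|%:R)) ->
  \sum_(j in ~: T) `|h j 0| <= \sum_(j in T) `|h j 0| ->
  m%:R / 2 * norm2 h ^+ 2 <= norm2 (M *m h) ^+ 2.
Proof.
move=> T0 cohM cone; set k : R := #|T|%:R.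
have k0 : 0 < k by rewrite ltr0n.
set s := \sum_j `|h j 0|.
have sT : s <= 2 * \sum_(j in T) `|h j 0|.
  rewrite /s (bigID (mem T)) /= mulr_natl mulr2n lerD2l.
  by under eq_bigl do rewrite -finset.in_setC.
have s0 : 0 <= s by apply: sumr_ge0.
have s2 : s ^+ 2 <= 4 * k * norm2 h ^+ 2.
  have : s ^+ 2 <= (2 * \sum_(j in T) `|h j 0|) ^+ 2.
    by rewrite ler_pXn2r ?nnegrE// (le_trans s0).
  move=> /le_trans; apply.
  rewrite exprMn -natrX -mulrA ler_pM2l//.
  apply: le_trans (sqr_sum_le_card _ _) _; rewrite ler_pM2l//.
  rewrite norm2_sqr [leRHS](bigID (mem T)) /=.
  under eq_bigr do rewrite real_normK ?num_real//.
  by rewrite lerDl sumr_ge0// => i _; exact: sqr_ge0.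
have MhE : norm2 (M *m h) ^+ 2 = \sum_j \sum_l h j 0 * h l 0 * gram M j l.
  rewrite norm2_sqr.
  transitivity (\sum_i \sum_j \sum_l (h j 0 * h l 0) * (M i j * M i l)).
    apply: eq_bigr => i _; rewrite mxE expr2 mulr_suml.
    apply: eq_bigr => j _; rewrite mulr_sumr.
    by apply: eq_bigr => l _; ring.
  rewrite exchange_big; apply: eq_bigr => j _.
  rewrite exchange_big; apply: eq_bigr => l _.
  by rewrite -mulr_sumr.
have diagE : m%:R * norm2 h ^+ 2 =
    \sum_j \sum_l h j 0 * h l 0 * (m%:R * (j == l)%:R).
  rewrite norm2_sqr mulr_sumr; apply: eq_bigr => j _.
  rewrite (bigD1 j) //= eqxx big1 => [|l /negbTE]; first by
    rewrite mulr1 addr0; ring.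
  by rewrite eq_sym => ->; rewrite !mulr0.
(* A quadratic form whose coefficients are at most [m / (8 k)] in absolute value is bounded by that
   constant times the squared l^1 norm [s ^+ 2]. *)
have diff : `|norm2 (M *m h) ^+ 2 - m%:R * norm2 h ^+ 2|
    <= m%:R / (8 * k) * s ^+ 2.
  rewrite MhE diagE -sumrB.
  apply: le_trans (ler_norm_sum _ _ _) _.
  have -> : m%:R / (8 * k) * s ^+ 2 =
      \sum_j \sum_l `|h j 0| * `|h l 0| * (m%:R / (8 * k)).
    rewrite mulrC expr2 mulr_suml mulr_suml; apply: eq_bigr => j _.
    by rewrite mulr_sumr mulr_suml.
  apply: ler_sum => j _; rewrite -sumrB.
  apply: le_trans (ler_norm_sum _ _ _) _; apply: ler_sum => l _.
  by rewrite -mulrBr !normrM ler_wpM2l ?mulr_ge0.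
(* The cone costs a factor [4 k], so the threshold [m / (8 k)] loses exactly half of [m |h|^2]. *)
have : m%:R / (8 * k) * s ^+ 2 <= m%:R / 2 * norm2 h ^+ 2.
  have -> : m%:R / 2 * norm2 h ^+ 2 =
      m%:R / (8 * k) * (4 * k * norm2 h ^+ 2) by field; rewrite gt_eqF.
  by rewrite ler_wpM2l// divr_ge0// mulr_ge0// ltW.
by move: diff; rewrite ler_norml => /andP[]; lra.
Qed.

End coherence.

(** * Deterministic error bounds for the two stages *)

Section reconstruction.
Context {R : realType}.

Lemma quantizer_error (delta t : R) : 0 < delta ->
  `|t - quantizer delta t| <= delta / 2.
Proof.
move=> d0; rewrite /quantizer; set c := Num.ceil _.
(* The shift by [2^-1] inside the ceiling turns the unit interval into one centred at [c], so
   [t / delta - c] lies in []-1/2, 1/2]]. *)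
have [lo hi] : (c - 1)%:~R < t / delta - 2^-1 /\ t / delta - 2^-1 <= c%:~R :> R.
  by have /andP[] := ceil_itv (t / delta - 2^-1).
have tE : t = t / delta * delta by rewrite divfK ?gt_eqF.
rewrite {1}tE -mulrBl normrM (gtr0_norm d0) [leRHS]mulrC ler_wpM2r ?(ltW d0)//.
by move: lo; rewrite intrB mulr1z ler_norml; lra.
Qed.

Lemma msq_error (delta : R) m (u : 'cV[R]_m) : 0 < delta ->
  norm2 (u - msq delta u) <= Num.sqrt m%:R * delta / 2.
Proof.
move=> d0; rewrite -mulrA; apply: norm2_le_card => [|i].
  by rewrite divr_ge0// ltW.
by rewrite !mxE; exact: quantizer_error.
Qed.

Variables (m n : nat) (Phi : 'M[R]_(m, n)) (delta : R) (x : 'cV[R]_n).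
Let T := supp x.
Let k := #|T|.
Let q := msq delta (Phi *m x).
Hypotheses (delta_gt0 : 0 < delta) (m_gt0 : (0 < m)%N) (k_gt0 : (0 < k)%N).
Hypothesis cohPhi : forall j l,
  `|gram Phi j l - m%:R * (j == l)%:R| <= m%:R / (8 * k%:R).

Let m0 : 0 < m%:R :> R. Proof. by rewrite ltr0n. Qed.

(** The quantization error makes [x] itself feasible, so minimality of [z] puts [z - x] in the cone.
    Two feasible points have images at distance at most [Num.sqrt m%:R * delta], and
    [gram_lower_bound] converts this into the bound on [z - x]. *)
Lemma l1_recovery (z : 'cV[R]_n) :
  l1_solution Phi q (Num.sqrt m%:R * delta / 2) z ->
  norm2 (z - x) ^+ 2 <= 2 * delta ^+ 2.
Proof.
move=> [feas zmin].
have feasx : norm2 (Phi *m x - q) <= Num.sqrt m%:R * delta / 2.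
  exact: msq_error.
have cone : \sum_(j in ~: T) `|(z - x) j 0| <= \sum_(j in T) `|(z - x) j 0|.
  have xC j : j \in ~: T -> x j 0 = 0.
    by rewrite !inE negbK => /eqP.
  have := zmin x feasx; rewrite /norm1.
  rewrite (bigID (mem T)) /= [leRHS](bigID (mem T)) /=.
  rewrite [X in _ + X <= _](eq_bigl (mem (~: T)%SET)) => [|j]; last first.
    by rewrite /= finset.in_setC.
  rewrite [X in _ <= _ + X]big1 => [|j]; last first.
    by rewrite -finset.in_setC => /xC ->; rewrite normr0.
  have -> : \sum_(j in (~: T)%SET) `|(z - x) j 0| =
      \sum_(j in (~: T)%SET) `|z j 0|.
    by apply: eq_bigr => j /xC xj; rewrite !mxE xj subr0.
  have : \sum_(j in T) `|x j 0| <=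
      \sum_(j in T) `|z j 0| + \sum_(j in T) `|(z - x) j 0|.
    rewrite -big_split /=; apply: ler_sum => j _; rewrite !mxE.
    by rewrite -lerBlDl distrC lerB_dist.
  lra.
have := gram_lower_bound k_gt0 cohPhi cone.
have le1 : norm2 (Phi *m (z - x)) <= Num.sqrt m%:R * delta.
  have -> : Phi *m (z - x) = (Phi *m z - q) + - (Phi *m x - q).
    by rewrite mulmxBr opprB addrA subrK.
  apply: le_trans (norm2D _ _) _; rewrite norm2N.
  by move: feas feasx; lra.
have c0 : 0 <= Num.sqrt m%:R * delta by rewrite mulr_ge0 ?sqrtr_ge0 ?ltW.
have : norm2 (Phi *m (z - x)) ^+ 2 <= (Num.sqrt m%:R * delta) ^+ 2.
  by apply: lerXn2r le1; rewrite nnegrE ?norm2_ge0.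
rewrite exprMn [Num.sqrt m%:R ^+ 2]sqr_sqrtr ?(ltW m0)// => le2 le3.
have := le_trans le3 le2.
rewrite -mulrA (ler_pM2l m0); lra.
Qed.

Hypothesis x_large : forall j, j \in T -> 3 * delta <= `|x j 0|.

(** Since 2 < (3/2)^2, each entry of [z] is within less than [3 / 2 * delta] of that of [x]. Hence
    entries of [z] off [T] are below [3 / 2 * delta] in magnitude and entries on [T] above it, and
    ties cannot interfere. *)
Lemma support_recovery (z : 'cV[R]_n) (S : {set 'I_n}) :
  l1_solution Phi q (Num.sqrt m%:R * delta / 2) z ->
  largest_entries k z S -> S = T.
Proof.
move=> zsol [cardS Slarge].
have near_x j : `|z j 0 - x j 0| < 3 / 2 * delta.
  have zx : `|z j 0 - x j 0| ^+ 2 <= 2 * delta ^+ 2.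
    apply: le_trans (l1_recovery zsol); rewrite norm2_sqr (bigD1 j)//= !mxE.
    rewrite real_normK ?num_real// lerDl.
    by apply: sumr_ge0 => i _; exact: sqr_ge0.
  rewrite -(ltr_pXn2r (n := 2))// ?nnegrE ?mulr_ge0 ?(ltW delta_gt0)//.
  apply: le_lt_trans zx _; rewrite exprMn ltr_pM2r ?exprn_gt0// expr2; lra.
apply/eqP; rewrite eqEcard cardS leqnn andbT.
apply/fintype.subsetP => i iS; apply/negPn/negP => iT.
(* [S] and [T] have the same cardinality, so an element of [S] outside [T] forces an element of [T]
   outside [S]. *)
have [j jT jS] : exists2 j, j \in T & j \notin S.
  apply/fintype.subsetPn; apply/negP => TS.
  have /eqP TSE : T == S by rewrite eqEcard TS cardS leqnn.
  by move: iT; rewrite TSE iS.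
have := Slarge _ _ iS jS; apply/negP; rewrite -ltNge.
have xi0 : x i 0 = 0 by move: iT; rewrite inE negbK => /eqP.
have := near_x i; rewrite xi0 subr0 => /lt_le_trans; apply.
have := x_large jT; have := near_x j.
have := lerB_dist (x j 0) (z j 0); rewrite distrC; lra.
Qed.

(** Once the support is known, [y] solves a least-squares problem on [T]. Its normal equations turn
    [|Phi h|^2], for [h = y - x], into minus the inner product of [h_T] with [g], and this is
    compared with the lower bound [m |h|^2 / 2]. *)
Lemma two_stage_error (y : 'cV[R]_n) :
  two_stage delta k Phi q y ->
  norm2 (y - x) <= 2 / m%:R *
    norm2 ((subcols T Phi)^T *m (Phi *m x - q)).
Proof.
move=> [z [S [zsol Slarge]]]; rewrite (support_recovery zsol Slarge).
move=> yT yE; set E := subcols T Phi; set g := E^T *m _.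
have xT : supp x \subset T by [].
set h := y - x.
have hT : supp h \subset T.
  apply/fintype.subsetP => j; rewrite inE !mxE; apply: contraNT => jT.
  have -> : y j 0 = 0.
    apply/eqP; apply: contraNT jT => yj0.
    by move/fintype.subsetP: yT; apply; rewrite inE.
  by move: jT; rewrite inE negbK => /eqP ->; rewrite subr0.
have [EBE _ EBs _] := mpinvP E.
have Phih : Phi *m h = E *m subentries T h by rewrite mulmx_subcols.
(* The normal equations follow from two of the Penrose conditions, without
   any rank assumption on [E]. *)
have normal : E^T *m (Phi *m h) = - g.
  rewrite /g -mulmxN opprB /h mulmxBr -(mulmx_subcols Phi yT) yE -/E.
  rewrite !mulmxBr; congr (_ - _).
  by rewrite (mulmxA E) mulmxA -EBs -trmx_mul EBE.
have hC j : j \notin T -> h j 0 = 0.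
  move=> jT; apply/eqP; apply: contraNT jT => hj.
  by move/fintype.subsetP: hT; apply; rewrite inE.
have cone : \sum_(j in ~: T) `|h j 0| <= \sum_(j in T) `|h j 0|.
  rewrite big1 ?sumr_ge0// => j; rewrite finset.in_setC => /hC ->.
  by rewrite normr0.
have lower := gram_lower_bound k_gt0 cohPhi cone.
have hE : norm2 h ^+ 2 = norm2 (subentries T h) ^+ 2.
  rewrite norm2_subentries_sqr norm2_sqr [LHS](bigID (mem T)) /=.
  by rewrite [X in _ + X]big1 ?addr0// => j /hC ->; rewrite expr0n.
have upper : norm2 (Phi *m h) ^+ 2 = - \sum_i subentries T h i 0 * g i 0.
  rewrite norm2_sqr.
  transitivity (((Phi *m h)^T *m (Phi *m h)) 0 0).
    by rewrite [RHS]mxE; apply: eq_bigr => i _; rewrite [_^T _ _]mxE expr2.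
  rewrite {1}Phih trmx_mul -mulmxA normal mulmxN mxE mxE.
  by congr (- _); apply: eq_bigr => i _; rewrite mxE.
apply: norm2_le; first by rewrite mulr_ge0 ?divr_ge0 ?norm2_ge0.
rewrite -norm2_sqr exprMn.
(* Young's inequality, with the weight [m / 4] chosen as half of the [m / 2] in [lower], so that the
   first term can be absorbed. *)
have : - \sum_i subentries T h i 0 * g i 0 <=
    m%:R / 4 * norm2 h ^+ 2 + norm2 g ^+ 2 / m%:R.
  rewrite hE !norm2_sqr mulr_sumr mulr_suml -sumrN -big_split /=.
  apply: ler_sum => i _; set a := subentries _ _ _ _; set b := g i 0.
  have -> : m%:R / 4 * a ^+ 2 + b ^+ 2 / m%:R =
      - (a * b) + (m%:R / 2 * a + b) ^+ 2 / m%:R.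
    by field; rewrite gt_eqF.
  by rewrite lerDl divr_ge0// sqr_ge0.
move: lower; rewrite upper => /le_trans /[apply] le_h.
have : m%:R / 4 * norm2 h ^+ 2 <= norm2 g ^+ 2 / m%:R by move: le_h; lra.
rewrite -ler_pdivlMl ?divr_gt0// => /le_trans; apply.
by rewrite le_eqVlt; apply/orP; left; apply/eqP; field; rewrite gt_eqF.
Qed.

End reconstruction.

(** * Independence *)

Section independence.
Context d (T : measurableType d) (R : realType) (P : probability T R).
Context (I : finType) (X : I -> {RV P >-> R}).

(** A pi-system containing the whole space that generates the sigma-algebra of the variables [X i]
    with [i \in J]. The family [B] is indexed by all of [I], but only its members over [J]
    matter. *)
Definition cylinders (J : {set I}) : set (set T) :=
  [set A | exists B : I -> set R, (forall i, measurable (B i)) /\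
     A = \bigcap_(i in [set` J]) X i @^-1` B i].

(** The sample space with the smaller sigma-algebra: measurability of [U : sigma_of J -> R]
    expresses that [U] depends only on the variables indexed by [J]. *)
Definition sigma_of (J : {set I}) := g_sigma_algebraType (cylinders J).

Lemma cylinders_measurable (J : {set I}) : cylinders J `<=` measurable.
Proof.
move=> _ [B [mB ->]]; apply: fin_bigcap_measurable => // i _.
by rewrite -[X in measurable X]setTI; exact: measurable_funPT.
Qed.

Lemma cylinders_setI (J : {set I}) : setI_closed (cylinders J).
Proof.
move=> _ _ [A [mA ->]] [B [mB ->]].
exists (fun i => A i `&` B i); split=> [i|]; first exact: measurableI.
by rewrite -bigcapI; apply: eq_bigcapr => i _; rewrite preimage_setI.
Qed.

Lemma cylinders_setT (J : {set I}) : cylinders J setT.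
Proof.
exists (fun=> setT); split=> //.
by apply/esym; rewrite -subTset => x _ i _.
Qed.

Lemma measurable_sigma_of (J : {set I}) (i : I) : i \in J ->
  measurable_fun setT (X i : sigma_of J -> R).
Proof.
move=> iJ _ B mB; rewrite setTI; apply: sub_sigma_algebra.
exists (fun j => if j == i then B else setT); split=> [j|].
  by case: ifP.
apply/seteqP; split=> [x XB j _ /=|x /(_ i iJ)]; last by rewrite eqxx.
by case: eqP => [->|].
Qed.

Lemma sigma_of_measurable (J : {set I}) (A : set T) :
  measurable (A : set (sigma_of J)) -> measurable A.
Proof.
apply: smallest_sub; first exact: sigma_algebra_measurable.
exact: cylinders_measurable.
Qed.

Hypothesis indepX : mutually_independent X.

(** Disjointness lets the two families of sets be merged into a single family [C]; mutual
    independence is then applied to [J1], [J2] and their union. *)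
Lemma cylinders_indep (J1 J2 : {set I}) (A B : set T) :
  {in J1, forall i, i \notin J2} ->
  cylinders J1 A -> cylinders J2 B -> (P (A `&` B) = P A * P B)%E.
Proof.
move=> J12 [A' [mA ->]] [B' [mB ->]].
pose C i := if i \in J1 then A' i else B' i.
have CJ1 i : i \in J1 -> C i = A' i by rewrite /C => ->.
have CJ2 i : i \in J2 -> C i = B' i.
  by rewrite /C; case: ifPn => // /J12 /negbTE ->.
have mC i : measurable (C i) by rewrite /C; case: ifP.
have -> : \bigcap_(i in [set` J1]) X i @^-1` A' i =
    \bigcap_(i in [set` J1]) X i @^-1` C i.
  by apply: eq_bigcapr => i /= /CJ1 ->.
have -> : \bigcap_(i in [set` J2]) X i @^-1` B' i =
    \bigcap_(i in [set` J2]) X i @^-1` C i.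
  by apply: eq_bigcapr => i /= /CJ2 ->.
rewrite -bigcap_setU.
have -> : [set` J1] `|` [set` J2] = [set` (J1 :|: J2)%SET].
  by apply/seteqP; split=> i /=; rewrite inE => /orP.
have dJ : fintype.disjoint (mem J1) (mem J2).
  by apply/pred0P => i /=; apply/negbTE/negP => /andP[/J12 /negP].
rewrite !indepX// -(bigU _ _ _ dJ); apply: eq_bigl => i; exact: finset.in_setU.
Qed.

(** Independence extends from the generating pi-systems to the sigma-algebras one argument at a
    time. *)
Lemma sigma_of_indep (J1 J2 : {set I}) (A B : set T) :
  {in J1, forall i, i \notin J2} ->
  measurable (A : set (sigma_of J1)) -> measurable (B : set (sigma_of J2)) ->
  (P (A `&` B) = P A * P B)%E.
Proof.
move=> J12 sA sB.
have mA := sigma_of_measurable sA; have mB := sigma_of_measurable sB.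
(* For fixed [D], the finite measures sending [C] to [P (C & D)] and to [P D * P C] agree on the
   cylinders, hence on the sigma-algebra they generate. *)
have step J (C D : set T) (mD : measurable D) :
    measurable (C : set (sigma_of J)) ->
    (forall C', cylinders J C' -> (P (C' `&` D) = P C' * P D)%E) ->
    (P (C `&` D) = P C * P D)%E.
  move=> sC indD.
  have PD0 : 0 <= fine (P D) by rewrite fine_ge0.
  have PDE : (P D = (fine (P D))%:E)%E by rewrite fineK ?fin_num_measure.
  rewrite muleC {1}PDE.
  have := @g_sigma_algebra_measure_unique _ R T (cylinders J)
    (@cylinders_measurable J) (fun=> setT) (fun=> cylinders_setT J)
    (bigcup_const _ (ex_intro _ 0%N Logic.I)) (mrestr P mD)
    (mscale (NngNum PD0) P) (@cylinders_setI J) _ _ C sC.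
  rewrite /mrestr/= /mscale/=; apply.
    by move=> C' cC'; rewrite -PDE muleC; exact: indD.
  move=> _; rewrite /= /mrestr setTI.
  exact: (le_lt_trans (probability_le1 _ mD) (ltry 1)).
apply: (step J1) => // C' cC'; rewrite setIC muleC.
apply: (step J2) => //; first exact: cylinders_measurable cC'.
by move=> D cD; rewrite setIC muleC; exact: (cylinders_indep J12).
Qed.

(** By [sigma_of_indep] the joint law of [(U, V)] is the product of the marginal laws, and Tonelli's
    theorem factors the integral. *)
Lemma integral_prod_indep (J1 J2 : {set I}) (U V : T -> R) :
  {in J1, forall i, i \notin J2} ->
  measurable_fun setT (U : sigma_of J1 -> R) ->
  measurable_fun setT (V : sigma_of J2 -> R) ->
  (forall w, 0 <= U w) -> (forall w, 0 <= V w) ->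
  (\int[P]_w (U w * V w)%:E = \int[P]_w (U w)%:E * \int[P]_w (V w)%:E)%E.
Proof.
move=> J12 sU sV U0 V0.
have mU : measurable_fun setT U.
  move=> _ B mB; apply: (@sigma_of_measurable J1); exact: sU.
have mV : measurable_fun setT V.
  move=> _ B mB; apply: (@sigma_of_measurable J2); exact: sV.
pose U' : {RV P >-> R} := mfun_Sub (mem_set mU).
pose V' : {RV P >-> R} := mfun_Sub (mem_set mV).
have mUV : measurable_fun setT (fun w => (U w, V w)).
  exact: measurable_fun_pair.
pose W : {RV P >-> _} := mfun_Sub (mem_set mUV).
pose RR : measurableType _ := (R * R)%type.
(* The absolute values make the integrand nonnegative on the whole plane, as Tonelli's theorem
   requires; they change nothing on the range of [(U, V)]. *)
pose f (p : RR) : \bar R := (`|p.1| * `|p.2|)%:E.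
have mf : measurable_fun [set: RR] f.
  by apply/measurable_EFinP; apply: measurable_funM;
     apply: measurableT_comp => //; apply: measurableT_comp.
have f0 p : (0 <= f p)%E by rewrite lee_fin mulr_ge0.
have jointE (A : set RR) : measurable A ->
    (distribution P U' \x distribution P V')%E A = distribution P W A.
  apply: product_measure_unique => {}A B mA mB.
  apply: (@sigma_of_indep J1 J2 (U @^-1` A) (V @^-1` B)) => //.
    by rewrite -[X in measurable X]setTI; exact: sU.
  by rewrite -[X in measurable X]setTI; exact: sV.
transitivity (\int[distribution P W]_p f p)%E.
  rewrite ge0_integral_distribution//; apply: eq_integral => w _.
  by rewrite /f /= !ger0_norm.
transitivity (\int[distribution P U' \x distribution P V']_p f p)%E.
  by apply: eq_measure_integral => A mA _; exact/esym/jointE.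
rewrite fubini_tonelli1//.
have mnorm : measurable_fun [set: R] (fun y : R => `|y|%:E).
  by apply/measurable_EFinP; exact: normr_measurable.
have normE (Z : {RV P >-> R}) : (forall w, 0 <= Z w) ->
    (\int[distribution P Z]_y `|y|%:E = \int[P]_w (Z w)%:E)%E.
  move=> Z0; rewrite ge0_integral_distribution//.
  by apply: eq_integral => w _; rewrite /= ger0_norm.
transitivity (\int[distribution P U']_x (`|x|%:E * \int[P]_w (V w)%:E))%E.
  apply: eq_integral => x _; rewrite /fubini_F.
  under eq_integral do rewrite /f /= EFinM.
  by rewrite ge0_integralZl// (normE V').
rewrite ge0_integralZr// ?(normE U')//.
by apply: integral_ge0 => w _; rewrite lee_fin.
Qed.

End independence.

(** * Exponential moments and concentration *)

Section real_exponential.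
Context {R : realType}.

(** For [u >= 0], the bound [expR u <= 1 + u * expR u] is used twice. For [u < 0] the second use is
    replaced by [u * expR (- u) <= u <= expR u - 1], which multiplication by [u] reverses. *)
Lemma expR_le_quad (u : R) : expR u <= 1 + u + u ^+ 2 * expR `|u|.
Proof.
have e1 : expR u <= 1 + u * expR u.
  have /(ler_wpM2r (expR_ge0 u)) := expR_ge1Dx (- u).
  by rewrite expRN mulVf ?expR_eq0// mulrBl mul1r; lra.
have [u0|u0] := leP 0 u.
  rewrite (ger0_norm u0); apply: (le_trans e1).
  rewrite -addrA lerD2l -lerBlDl -[X in _ - X]mulr1 -mulrBr expr2 -mulrA.
  by apply: ler_wpM2l => //; rewrite lerBlDl.
rewrite (ltr0_norm u0); apply: (le_trans e1).
rewrite -addrA lerD2l -lerBlDl -[X in _ - X]mulr1 -mulrBr expr2 -mulrA.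
rewrite ler_nM2l//.
have := expR_ge1Dx u; have : 1 <= expR (- u).
  by apply: le_trans (expR_ge1Dx _); rewrite lerDl oppr_ge0 ltW.
by move=> /(ler_wnM2l (ltW u0)); rewrite mulr1; lra.
Qed.

(** With [u = a * |w|], squaring [u / 4 <= expR (u / 4)] bounds [w ^+ 2] by
    [16 / a ^+ 2 * expR (u / 2)]. *)
Lemma sqr_le_expR (a w : R) : 0 < a ->
  w ^+ 2 * expR (a / 2 * `|w|) <= 16 / a ^+ 2 * expR (a * `|w|).
Proof.
move=> a0; set u := a * `|w|.
have u0 : 0 <= u by rewrite mulr_ge0// ltW.
have -> : a / 2 * `|w| = u / 2 by rewrite /u; ring.
have -> : expR u = expR (u / 2) * expR (u / 2).
  by rewrite -expRD -splitr.
rewrite mulrA ler_wpM2r ?expR_ge0//.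
have : (u / 4) ^+ 2 <= expR (u / 2).
  have -> : u / 2 = u / 4 + u / 4 by field.
  rewrite expRD -expr2 lerXn2r ?nnegrE ?expR_ge0 ?divr_ge0//.
  by apply: le_trans (expR_ge1Dx _); rewrite lerDr.
rewrite /u exprMn exprMn real_normK ?num_real// => h.
rewrite -ler_pdivrMl ?divr_gt0 ?exprn_gt0//.
apply: le_trans h; rewrite le_eqVlt; apply/orP; left; apply/eqP.
by field; rewrite gt_eqF.
Qed.

(** The left side is a single term of the exponential series at [n]. This weak form of Stirling's
    bound cancels the growth [n ^ n] of sub-Gaussian moments. *)
Lemma exprnn_le_fact (n : nat) :
  n%:R ^+ n / n`!%:R <= expR 1 ^+ n :> R.
Proof.
case: n => [|n]; first by rewrite !expr0 fact0 divr1.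
rewrite -expRM_natl mulr1.
by apply: le_trans (expR_ge1Dxn n (ler0n R n.+1)); rewrite lerDr.
Qed.

Lemma expR_eseries (y : R) :
  ((expR y)%:E = \sum_(n <oo) (y ^+ n / n`!%:R)%:E)%E.
Proof.
apply/esym/cvg_lim => //.
rewrite (_ : (fun _ => _) = EFin \o series (exp_coeff y)).
  by apply: cvg_EFin; [exact: nearW | exact: is_cvg_series_exp_coeff].
by apply/funext => n /=; rewrite sumEFin.
Qed.

End real_exponential.

(** * Moments of sub-Gaussian variables *)

Section subgaussian.
Context d (T : measurableType d) (R : realType) (P : probability T R).

(** The exponent [p = 2 n] in the supremum defining the norm; raising to the power [p] turns
    [p^(1/2)] into [(2 n)^n]. *)
Lemma subgaussian_even_moment (K : R) (X : {RV P >-> R}) (n : nat) : 0 < K ->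
  (subgaussian_norm X <= K%:E)%E -> (0 < n)%N ->
  (\int[P]_w (X w ^+ (2 * n))%:E <= ((2 * n%:R * K ^+ 2) ^+ n)%:E)%E.
Proof.
move=> K0 XK n0; set p : R := (2 * n)%:R.
have p1 : 1 <= p by rewrite ler1n muln_gt0.
have p0 : 0 < p by exact: lt_le_trans p1.
have : ((p `^ (- 2^-1))%:E * 'N[P]_(p%:E)[EFin \o X] <= K%:E)%E.
  by apply: le_trans XK; apply: ereal_sup_ubound; exists p.
rewrite powRN -lee_pdivlMl ?invr_gt0 ?powR_gt0// invrK => NK.
have : ('N[P]_(p%:E)[EFin \o X] `^ p <= ((p `^ 2^-1 * K)%:E `^ p))%E.
  apply: gt0_ler_poweR NK; rewrite ?ltW// in_itv/= leey andbT ?Lnorm_ge0//.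
  by rewrite lee_fin mulr_ge0 ?powR_ge0// ltW.
rewrite poweR_Lnorm ?gt_eqF// poweR_EFin => h.
rewrite (_ : (2 * _ * _) ^+ n = (p `^ 2^-1 * K) `^ p).
  apply: le_trans h; rewrite le_eqVlt; apply/orP; left; apply/eqP.
  apply: eq_integral => w _ /=; congr EFin.
  rewrite powR_mulrn// -normrX ger0_norm//.
  by rewrite mulnC exprM sqr_ge0.
rewrite powR_mulrn ?mulr_ge0 ?powR_ge0 ?ltW// exprM; congr (_ ^+ n).
rewrite exprMn powR12_sqrt ?ltW// sqr_sqrtr ?ltW//.
by rewrite /p natrM.
Qed.

(** The exponential series is integrated term by term. By the even moments and [exprnn_le_fact] the
    n-th term is at most [(2 a K^2 e)^n], and the rate is chosen to make this [2^-n], whose sum is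
    2. *)
Lemma subgaussian_exp_sqr (K : R) (X : {RV P >-> R}) : 0 < K ->
  (subgaussian_norm X <= K%:E)%E ->
  (\int[P]_w (expR ((4 * expR 1 * K ^+ 2)^-1 * X w ^+ 2))%:E <= 2%:E)%E.
Proof.
move=> K0 XK; set a := (_)^-1.
have a0 : 0 < a by rewrite invr_gt0 !mulr_gt0 ?expR_gt0 ?exprn_gt0.
pose f n w := ((a * X w ^+ 2) ^+ n / n`!%:R)%:E.
have f0 n w : (0 <= f n w)%E.
  by rewrite lee_fin divr_ge0// exprn_ge0// mulr_ge0 ?sqr_ge0// ltW.
have mf n : measurable_fun setT (f n).
  apply/measurable_EFinP; apply: measurable_funM => //.
  apply: measurable_funX; apply: measurable_funM => //.
  exact: measurable_funX.
(* The bound [2^-n] is written in the shape of the geometric series summed at the end. *)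
have fE n : (\int[P]_w f n w <= (2 / (2 ^ (n + 1))%:R)%:E)%E.
  have -> : 2 / (2 ^ (n + 1))%:R = 2^-1 ^+ n :> R.
    by rewrite addn1 expnS natrM invfM mulVKf// natrX exprVn.
  have [->|n0] := posnP n.
    under eq_integral do rewrite /f expr0 fact0 divr1.
    by rewrite integral_cst//= probability_setT mule1 expr0.
  have fnE w : f n w = ((a ^+ n / n`!%:R)%:E * (X w ^+ (2 * n))%:E)%E.
    by rewrite /f -EFinM exprMn -exprM; congr EFin; ring.
  under eq_integral do rewrite fnE.
  rewrite ge0_integralZl//; last 3 first.
  - by apply/measurable_EFinP; exact: measurable_funX.
  - by move=> w _; rewrite lee_fin exprM exprn_ge0// sqr_ge0.
  - by rewrite lee_fin divr_ge0// exprn_ge0// ltW.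
  have := subgaussian_even_moment K0 XK n0 => h.
  apply: (@le_trans _ _
    ((a ^+ n / n`!%:R)%:E * ((2 * n%:R * K ^+ 2) ^+ n)%:E)%E).
    by rewrite lee_wpmul2l// lee_fin divr_ge0// exprn_ge0// ltW.
  rewrite -EFinM lee_fin.
  have -> : a ^+ n / n`!%:R * (2 * n%:R * K ^+ 2) ^+ n =
      (2 * a * K ^+ 2) ^+ n * (n%:R ^+ n / n`!%:R) by rewrite !exprMn; ring.
  have c0 : 0 <= 2 * a * K ^+ 2 by rewrite !mulr_ge0 ?sqr_ge0// ltW.
  apply: (@le_trans _ _ ((2 * a * K ^+ 2) ^+ n * expR 1 ^+ n)).
    by rewrite ler_wpM2l ?exprn_ge0// exprnn_le_fact.
  rewrite -exprMn le_eqVlt; apply/orP; left; apply/eqP; congr (_ ^+ n).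
  by rewrite /a; field; rewrite !gt_eqF ?expR_gt0.
under eq_integral do rewrite expR_eseries.
rewrite (@integral_nneseries _ _ _ P setT measurableT f)//.
apply: (@le_trans _ _ (\sum_(n <oo) (2 / (2 ^ (n + 1))%:R)%:E)%E).
  apply: lee_nneseries => [n _ _|n _]; last exact: fE.
  by apply: integral_ge0 => w _; exact: f0.
have /cvg_lim -> // := @cvg_geometric_eseries_half R 2 0.
by rewrite expr0 divr1.
Qed.

End subgaussian.

(** * Exponential moments: means, centering, products and moment generating functions *)

Section exponential_moments.
Context d (T : measurableType d) (R : realType) (P : probability T R).
Implicit Types (U V W : T -> R) (a M r : R).

Lemma measurable_exp_norm a W : measurable_fun setT W ->
  measurable_fun setT (fun w => expR (a * `|W w|)).
Proof.
move=> mW; apply: measurableT_comp => //; apply: measurable_funM => //.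
exact: measurableT_comp.
Qed.

Lemma exp_norm_integrable a M W : measurable_fun setT W ->
  (\int[P]_w (expR (a * `|W w|))%:E <= M%:E)%E ->
  P.-integrable setT (fun w => (expR (a * `|W w|))%:E).
Proof.
move=> mW WM; apply/integrableP; split.
  by apply/measurable_EFinP; exact: measurable_exp_norm.
under eq_integral do rewrite abse_EFin ger0_norm ?expR_ge0//.
exact: le_lt_trans WM (ltry _).
Qed.

Lemma le_exp_norm a (u : R) : 0 < a -> `|u| <= a^-1 * expR (a * `|u|).
Proof.
move=> a0; rewrite ler_pdivlMl//; apply: le_trans (expR_ge1Dx _).
by rewrite lerDr.
Qed.

Lemma exp_moment_integrable a M W : 0 < a -> measurable_fun setT W ->
  (\int[P]_w (expR (a * `|W w|))%:E <= M%:E)%E ->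
  P.-integrable setT (EFin \o W).
Proof.
move=> a0 mW WM.
apply: (@le_integrable _ _ _ P _ measurableT _
  (fun w => (a^-1)%:E * (expR (a * `|W w|))%:E)%E).
- exact/measurable_EFinP.
- move=> w _ /=; rewrite lee_fin [leRHS]ger0_norm; first exact: le_exp_norm.
  by rewrite mulr_ge0 ?expR_ge0// invr_ge0 ltW.
- by apply: integrableZl => //; exact: exp_norm_integrable WM.
Qed.

Lemma exp_moment_mean a M W : 0 < a -> measurable_fun setT W ->
  (\int[P]_w (expR (a * `|W w|))%:E <= M%:E)%E ->
  a * `|fine (\int[P]_w (W w)%:E)| <= M.
Proof.
move=> a0 mW WM; have iW := exp_moment_integrable a0 mW WM.
rewrite -lee_fin EFinM -abse_EFin fineK; last exact: integrable_fin_num.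
apply: le_trans WM.
apply: (@le_trans _ _ (a%:E * \int[P]_w `|(W w)%:E|)%E).
  rewrite lee_pmul2l ?lte_fin//; apply: le_abse_integral => //.
  exact/measurable_EFinP.
rewrite -ge0_integralZl//; last 2 first.
- by apply: measurableT_comp => //; exact/measurable_EFinP.
- by rewrite lee_fin ltW.
apply: ge0_le_integral => //.
- by move=> w _; rewrite mule_ge0// lee_fin ltW.
- apply: measurable_funeM; apply: measurableT_comp => //.
  exact/measurable_EFinP.
- by apply/measurable_EFinP; exact: measurable_exp_norm.
- move=> w _; rewrite -EFinM lee_fin.
  by apply: le_trans (expR_ge1Dx _); rewrite lerDr.
Qed.

(** By [exp_moment_mean] the mean [c] satisfies [a * |c| <= M], so subtracting it costs at most a
    factor [expR M]. *)
Lemma exp_moment_center a M W : 0 < a -> measurable_fun setT W ->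
  (\int[P]_w (expR (a * `|W w|))%:E <= M%:E)%E ->
  (\int[P]_w (expR (a * `|W w - fine (\int[P]_v (W v)%:E)|))%:E
     <= (expR M * M)%:E)%E.
Proof.
move=> a0 mW WM; have := exp_moment_mean a0 mW WM.
set c := fine _ => cM.
apply: (@le_trans _ _ ((expR M)%:E * \int[P]_w (expR (a * `|W w|))%:E)%E).
  rewrite -ge0_integralZl//; last first.
    by apply/measurable_EFinP; exact: measurable_exp_norm.
  apply: ge0_le_integral => //.
  - apply/measurable_EFinP; apply: measurable_exp_norm.
    exact: measurable_funB.
  - apply: measurable_funeM.
    by apply/measurable_EFinP; exact: measurable_exp_norm.
  - move=> w _; rewrite -EFinM lee_fin -expRD ler_expR.
    apply: le_trans (_ : a * (`|W w| + `|c|) <= _); last first.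
      by rewrite mulrDr [leRHS]addrC lerD2l.
    by rewrite ler_pM2l// ler_normB.
by rewrite EFinM lee_wpmul2l// lee_fin expR_ge0.
Qed.

(** The arithmetic-geometric mean inequality is used twice, in the exponent and between the
    exponentials. This covers dependent factors, such as an entry and the quantization error of its
    own row. *)
Lemma exp_moment_prod a M U V : 0 <= a ->
  measurable_fun setT U -> measurable_fun setT V ->
  (\int[P]_w (expR (a * U w ^+ 2))%:E <= M%:E)%E ->
  (\int[P]_w (expR (a * V w ^+ 2))%:E <= M%:E)%E ->
  (\int[P]_w (expR (a * `|U w * V w|))%:E <= M%:E)%E.
Proof.
move=> a0 mU mV UM VM.
have mexp (Z : T -> R) : measurable_fun setT Z ->
    measurable_fun setT (fun w => (expR (a * Z w ^+ 2))%:E).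
  move=> mZ; apply/measurable_EFinP; apply: measurableT_comp => //.
  by apply: measurable_funM => //; exact: measurable_funX.
have M2 : M%:E = ((2^-1)%:E * (M%:E + M%:E))%E.
  by rewrite -EFinD -EFinM; congr EFin; field.
rewrite M2; apply: le_trans (_ : ((2^-1)%:E *
  (\int[P]_w (expR (a * U w ^+ 2))%:E +
   \int[P]_w (expR (a * V w ^+ 2))%:E) <= _)%E); last first.
  by rewrite lee_wpmul2l// ?lee_fin// leeD.
rewrite -ge0_integralD//; [|exact: mexp..].
rewrite -ge0_integralZl//; last 2 first.
- by apply: emeasurable_funD; exact: mexp.
- by move=> w _; rewrite adde_ge0.
apply: ge0_le_integral => //.
- by apply/measurable_EFinP; apply: measurable_exp_norm; exact: measurable_funM.
- by apply: measurable_funeM; apply: emeasurable_funD; exact: mexp.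
move=> w _; rewrite -EFinD -EFinM lee_fin.
set u := expR (a / 2 * U w ^+ 2); set v := expR (a / 2 * V w ^+ 2).
have -> : expR (a * U w ^+ 2) = u ^+ 2.
  by rewrite [RHS]expr2 /u -expRD; congr expR; field.
have -> : expR (a * V w ^+ 2) = v ^+ 2.
  by rewrite [RHS]expr2 /v -expRD; congr expR; field.
apply: (@le_trans _ _ (u * v)); last first.
  by have := sqr_ge0 (u - v); rewrite sqrrB; lra.
rewrite /u /v -expRD ler_expR -mulrDr -mulrA ler_wpM2l// normrM.
rewrite -[U w ^+ 2]real_normK ?num_real// -[V w ^+ 2]real_normK ?num_real//.
by have := sqr_ge0 (`|U w| - `|V w|); rewrite sqrrB; lra.
Qed.

(* The quadratic Taylor bound for [expR]: its linear term has mean zero, and the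
   remainder is absorbed by half of the available exponential moment. *)
Lemma mgf_le_gaussian a M r W : 0 < a -> measurable_fun setT W ->
  (\int[P]_w (W w)%:E = 0)%E ->
  (\int[P]_w (expR (a * `|W w|))%:E <= M%:E)%E -> `|r| <= a / 2 ->
  (\int[P]_w (expR (r * W w))%:E <= (expR (16 / a ^+ 2 * M * r ^+ 2))%:E)%E.
Proof.
move=> a0 mW W0 WM ra.
(* Since [|r| <= a / 2], the remainder of [expR_le_quad] is at most
   [r ^+ 2 * W ^+ 2 * expR (a / 2 * |W|)], which [sqr_le_expR] bounds by [f2]. *)
pose c := r ^+ 2 * (16 / a ^+ 2).
have c0 : 0 <= c by rewrite mulr_ge0 ?sqr_ge0// divr_ge0// sqr_ge0.
have iW := exp_moment_integrable a0 mW WM.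
have iE := exp_norm_integrable mW WM.
pose f1 w := 1 + r * W w; pose f2 w := c * expR (a * `|W w|).
have if1 : P.-integrable setT (EFin \o f1).
  rewrite (_ : _ \o _ = (fun w => (EFin \o cst 1%R) w + r%:E * (W w)%:E)%E)//.
  apply: integrableD => //; first exact: finite_measure_integrable_cst.
  exact: integrableZl.
have if2 : P.-integrable setT (EFin \o f2).
  exact: (integrableZl measurableT c iE).
apply: (@le_trans _ _ (\int[P]_w ((EFin \o f1) w + (EFin \o f2) w))%E).
  apply: ge0_le_integral => //.
  - apply/measurable_EFinP; apply: measurableT_comp => //.
    exact: measurable_funM.
  - by apply: emeasurable_funD; [case/integrableP: if1|case/integrableP: if2].
  move=> w _; rewrite /= -EFinD lee_fin.
  apply: (le_trans (expR_le_quad _)); rewrite lerD2l /f2 /c exprMn.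
  rewrite -[leLHS]mulrA -[leRHS]mulrA ler_wpM2l ?sqr_ge0//.
  apply: le_trans (sqr_le_expR _ a0).
  by rewrite ler_wpM2l ?sqr_ge0// ler_expR normrM ler_wpM2r.
rewrite integralD_EFin//.
have -> : (\int[P]_w (EFin \o f1) w = 1)%E.
  rewrite (_ : EFin \o f1 =
    (fun w => (EFin \o cst 1%R) w + (EFin \o (fun v => r * W v)%R) w)%E)//.
  rewrite integralD_EFin//; last 2 first.
  - exact: finite_measure_integrable_cst.
  - exact: (integrableZl measurableT r iW).
  rewrite /= integral_cst//= probability_setT mule1.
  under eq_integral do rewrite EFinM.
  by rewrite integralZl// W0 mule0 adde0.
have -> : (\int[P]_w (EFin \o f2) w =
    c%:E * \int[P]_w (expR (a * `|W w|))%:E)%E.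
  by rewrite -(integralZl measurableT iE).
apply: (@le_trans _ _ (1 + c%:E * M%:E)%E).
  by rewrite leeD2l// lee_wpmul2l// lee_fin.
rewrite -EFinM -EFinD lee_fin; apply: le_trans (expR_ge1Dx _).
by rewrite lerD2l /c le_eqVlt; apply/orP; left; apply/eqP; ring.
Qed.

End exponential_moments.

(** * Concentration of sums over independent blocks of variables *)

Section blocks.
Context d (T : measurableType d) (R : realType) (P : probability T R).
Context (I J : finType) (X : I -> {RV P >-> R}) (block : I -> J).
Implicit Types (s : seq J) (j : J).

Lemma sigma_of_mono (J1 J2 : {set I}) (U : T -> R) : {subset J1 <= J2} ->
  measurable_fun setT (U : sigma_of X J1 -> R) ->
  measurable_fun setT (U : sigma_of X J2 -> R).
Proof.
move=> J12 mU _ B mB; have := mU measurableT B mB; rewrite !setTI.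
apply: smallest_sub; first exact: smallest_sigma_algebra.
move=> _ [A [mA ->]]; apply: sub_sigma_algebra.
exists (fun i => if i \in J1 then A i else setT); split=> [i|].
  by case: ifP.
apply/seteqP; split=> w wA i /= iJ.
  by case: ifPn => // iJ1; exact: wA.
by have := wA i (J12 i iJ); rewrite iJ.
Qed.

(** For the random matrix, [block] is [fst]: the blocks are the rows, independent of one another. *)
Definition block_of s : {set I} := [set i | block i \in s]%SET.

Definition block_measurable j (U : T -> R) :=
  measurable_fun setT (U : sigma_of X (block_of [:: j]) -> R).

Lemma block_measurableP j (U : T -> R) :
  block_measurable j U -> measurable_fun setT U.
Proof.
by move=> mU _ B mB; apply: (@sigma_of_measurable _ _ _ _ _ X); exact: mU.
Qed.

Lemma block_measurable_var j i : block i = j -> block_measurable j (X i).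
Proof. by move=> bi; apply: measurable_sigma_of; rewrite inE bi mem_head. Qed.

Hypothesis indepX : mutually_independent X.

(** Induction on [s]: uniqueness keeps the block of the head apart from those of the tail, and the
    tail product is measurable for the union of its blocks. *)
Lemma integral_prod_blocks s (U : J -> T -> R) : uniq s ->
  (forall j, block_measurable j (U j)) -> (forall j w, 0 <= U j w) ->
  (\int[P]_w (\prod_(j <- s) U j w)%:E =
   \prod_(j <- s) \int[P]_w (U j w)%:E)%E.
Proof.
move=> us mU U0; elim: s us => [_|j s IH /= /andP[js us]].
  rewrite big_nil; under eq_integral do rewrite big_nil.
  by rewrite integral_cst//= probability_setT mule1.
under eq_integral do rewrite big_cons.
rewrite big_cons -IH//.
have := @integral_prod_indep _ _ _ P _ X indepX (block_of [:: j])
  (block_of s) (U j) (fun w => \prod_(i <- s) U i w).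
apply => //.
- move=> i; rewrite !inE => /eqP ->; exact: js.
- exact: mU.
- apply: (@measurable_prod _ (sigma_of X (block_of s))) => i si.
  apply: sigma_of_mono (mU i) => i'.
  by rewrite !inE => /eqP ->.
- by move=> w; exact: prodr_ge0.
Qed.

Lemma chernoff_blocks (W : J -> T -> R) (a M B t : R) : 0 < a ->
  (forall j, block_measurable j (W j)) ->
  (forall j, (\int[P]_w (W j w)%:E = 0)%E) ->
  (forall j, (\int[P]_w (expR (a * `|W j w|))%:E <= M%:E)%E) ->
  0 < B -> 16 / a ^+ 2 * M <= B -> 0 < t -> t <= a * B ->
  (P [set w | (#|J|%:R * t <= \sum_j W j w)%R] <=
   (expR (- (#|J|%:R * t ^+ 2 / (4 * B))))%:E)%E.
Proof.
move=> a0 mW W0 WM B0 MB t0 taB.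
(* The minimizer of [B * r ^+ 2 - r * t], with minimum [- t ^+ 2 / (4 * B)]. The condition
   [t <= a * B] keeps [r] in the range of [mgf_le_gaussian]. *)
pose r := t / (2 * B).
have r0 : 0 < r by rewrite divr_gt0 ?mulr_gt0.
have ra : `|r| <= a / 2.
  rewrite gtr0_norm// /r ler_pdivrMr ?mulr_gt0//.
  by rewrite (_ : a / 2 * (2 * B) = a * B)//; field.
have mS : measurable_fun setT (fun w => \sum_j W j w).
  by apply: measurable_sum => j; exact: block_measurableP (mW j).
pose S : {RV P >-> R} := mfun_Sub (mem_set mS).
have := @chernoff _ _ _ P S r (#|J|%:R * t) r0.
move=> /le_trans; apply.
have SE : ('M_P S r <= (expR (B * r ^+ 2 *+ #|J|))%:E)%E.
  rewrite /mmt_gen_fun unlock.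
  rewrite (_ : (\int[P]_w _ =
    \int[P]_w (\prod_j expR (r * W j w))%:E)%E); last first.
    by apply: eq_integral => w _ /=; rewrite -expR_sum -mulr_sumr mulrC.
  rewrite integral_prod_blocks ?index_enum_uniq//; last first.
    move=> j; rewrite /block_measurable; apply: measurableT_comp => //.
    by apply: measurable_funM => //; exact: mW.
  apply: (@le_trans _ _ (\prod_(j : J) (expR (B * r ^+ 2))%:E)%E).
    (* Nonnegativity is carried through the induction because multiplying inequalities of extended
       reals needs it. *)
    have [//] : (0 <= \prod_j \int[P]_w (expR (r * W j w))%:E)%E /\
        (\prod_j \int[P]_w (expR (r * W j w))%:E <=
         \prod_(j : J) (expR (B * r ^+ 2))%:E)%E.
    apply: (big_ind2 (fun x y => (0 <= x)%E /\ (x <= y)%E)) => //.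
    + move=> x1 x2 y1 y2 [x10 x12] [y10 y12]; split; first exact: mule_ge0.
      exact: lee_pmul.
    + move=> j _; split.
        by apply: integral_ge0 => w _; rewrite lee_fin expR_ge0.
      apply: le_trans (mgf_le_gaussian a0 _ (W0 j) (WM j) ra) _.
        exact: block_measurableP (mW j).
      by rewrite lee_fin ler_expR ler_wpM2r// sqr_ge0.
  by rewrite prodEFin prodr_const -expRM_natl mulr_natl.
apply: (@le_trans _ _ ((expR (B * r ^+ 2 *+ #|J|))%:E *
    (expR (- (r * (#|J|%:R * t))))%:E)%E).
  by rewrite lee_wpmul2r// lee_fin expR_ge0.
rewrite -EFinM -expRD lee_fin ler_expR -mulr_natl /r le_eqVlt.
by apply/orP; left; apply/eqP; field; rewrite gt_eqF.
Qed.

(** The one-sided bound for [W] and for [- W], whence the factor 2. *)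
Lemma bernstein_blocks (W : J -> T -> R) (a M B t : R) : 0 < a ->
  (forall j, block_measurable j (W j)) ->
  (forall j, (\int[P]_w (W j w)%:E = 0)%E) ->
  (forall j, (\int[P]_w (expR (a * `|W j w|))%:E <= M%:E)%E) ->
  0 < B -> 16 / a ^+ 2 * M <= B -> 0 < t -> t <= a * B ->
  (P [set w | (#|J|%:R * t <= `|\sum_j W j w|)%R] <=
   (2 * expR (- (#|J|%:R * t ^+ 2 / (4 * B))))%:E)%E.
Proof.
move=> a0 mW W0 WM B0 MB t0 taB.
have mS : measurable_fun setT (fun w => \sum_j W j w).
  by apply: measurable_sum => j; exact: block_measurableP (mW j).
have mle (f : T -> R) : measurable_fun setT f ->
    measurable [set w | #|J|%:R * t <= f w].
  move=> mf; rewrite -[X in measurable X]setTI.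
  exact: (measurable_fun_le measurableT (measurable_cst _) mf).
have -> : [set w | #|J|%:R * t <= `|\sum_j W j w|] =
    [set w | #|J|%:R * t <= \sum_j W j w] `|`
    [set w | #|J|%:R * t <= \sum_j - W j w].
  by apply/seteqP; split=> w /=; rewrite sumrN ler_normr => /orP.
apply: (le_trans (measureU2 P _ _)).
- exact: mle.
- by apply: mle; apply: measurable_sum => j; apply: measurable_funN;
     exact: block_measurableP (mW j).
rewrite [2 * _]mulr_natl mulr2n EFinD leeD//.
  exact: (chernoff_blocks a0 mW W0 WM).
apply: (@chernoff_blocks (fun j w => - W j w) a M) => //.
- by move=> j; apply: measurable_funN; exact: mW.
- move=> j; under eq_integral do rewrite EFinN.
  have iW := exp_moment_integrable a0 (block_measurableP (mW j)) (WM j).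
  by rewrite integralN ?W0 ?oppe0//; exact: integrable_add_def.
- by move=> j; under eq_integral do rewrite normrN.
Qed.

(* Products of two variables with a Gaussian exponential moment have a simple
   exponential moment, so Bernstein's inequality applies to them. *)
Lemma product_concentration (U V : J -> T -> R) (a M t : R) :
  0 < a -> 0 <= M ->
  (forall j, block_measurable j (U j)) ->
  (forall j, block_measurable j (V j)) ->
  (forall j, (\int[P]_w (expR (a * U j w ^+ 2))%:E <= M%:E)%E) ->
  (forall j, (\int[P]_w (expR (a * V j w ^+ 2))%:E <= M%:E)%E) ->
  0 < t -> t <= 1 ->
  (P [set w | (#|J|%:R * t <= `|\sum_j (U j w * V j w -
        fine (\int[P]_v (U j v * V j v)%:E))|)%R] <=
   (2 * expR (- (#|J|%:R * t ^+ 2 /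
       (4 * (16 / a ^+ 2 * (expR M * M) + a^-1)))))%:E)%E.
Proof.
(* The first summand of [B] comes from the exponential moment of the centered products; the summand
   [a^-1] ensures [B > 0] and [a * B >= 1 >= t]. *)
move=> a0 M0 mU mV UM VM t0 t1; set B := _ + a^-1.
have mUV j : measurable_fun setT (fun w => U j w * V j w).
  by apply: measurable_funM; apply: block_measurableP; [exact: mU|exact: mV].
have YM j := exp_moment_prod (ltW a0) (block_measurableP (mU j))
  (block_measurableP (mV j)) (UM j) (VM j).
have EM0 : 0 <= 16 / a ^+ 2 * (expR M * M).
  by rewrite !mulr_ge0 ?expR_ge0// invr_ge0 sqr_ge0.
apply: (@bernstein_blocks (fun j w => U j w * V j w -
    fine (\int[P]_v (U j v * V j v)%:E)) a (expR M * M)) => //.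
- by move=> j; apply: measurable_funB => //; apply: measurable_funM;
    [exact: mU|exact: mV].
- move=> j; have iY := exp_moment_integrable a0 (mUV j) (YM j).
  under eq_integral do rewrite EFinB.
  rewrite integralB//; last exact: finite_measure_integrable_cst.
  rewrite integral_cst//= probability_setT mule1 fineK ?subee//.
    exact: integrable_fin_num.
  exact: integrable_fin_num.
- by move=> j; exact: exp_moment_center (YM j).
- by rewrite ltr_wpDl// invr_gt0.
- by rewrite lerDl invr_ge0 ltW.
- apply: (le_trans t1); rewrite mulrDr mulfV ?gt_eqF// lerDr.
  by rewrite mulr_ge0// ltW.
Qed.

End blocks.

(** * Product formula for signed independent variables, and the union bound *)

Section signed_product.
Context d (T : measurableType d) (R : realType) (P : probability T R).

(* Reduces the product formula to nonnegative factors: [U] is the difference of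
   [|U| + U] and [|U|]. *)
Lemma integral_prod_abs_split (U V : T -> R) :
  P.-integrable setT (EFin \o U) -> P.-integrable setT (EFin \o V) ->
  P.-integrable setT (EFin \o (fun w => U w * V w)) ->
  (\int[P]_w ((`|U w| + U w) * V w)%:E =
   \int[P]_w (`|U w| + U w)%:E * \int[P]_w (V w)%:E)%E ->
  (\int[P]_w (`|U w| * V w)%:E =
   \int[P]_w (`|U w|)%:E * \int[P]_w (V w)%:E)%E ->
  (\int[P]_w (U w * V w)%:E = \int[P]_w (U w)%:E * \int[P]_w (V w)%:E)%E.
Proof.
move=> iU iV iUV h1 h2.
have iaU : P.-integrable setT (EFin \o (fun w => `|U w|)).
  by have := integrable_abse iU.
have mU : measurable_fun setT U by apply/measurable_EFinP; case/integrableP: iU.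
have mV : measurable_fun setT V by apply/measurable_EFinP; case/integrableP: iV.
have iaUV : P.-integrable setT (EFin \o (fun w => `|U w| * V w)).
  apply: le_integrable iUV => //.
    apply/measurable_EFinP; apply: measurable_funM => //.
    exact: measurableT_comp.
  by move=> w _ /=; rewrite lee_fin !normrM normr_id.
move: h1.
under eq_integral do rewrite mulrDl EFinD.
rewrite (integralD_EFin measurableT iaUV iUV) h2.
under [X in _ = (X * _)%E]eq_integral do rewrite EFinD.
rewrite (integralD_EFin measurableT iaU iU).
have := integrable_fin_num measurableT iU.
have := integrable_fin_num measurableT iV.
have := integrable_fin_num measurableT iUV.
have := integrable_fin_num measurableT iaU.
rewrite /comp.
case: (\int[P]_w `|U w|%:E)%E => // a _.
case: (\int[P]_w (U w * V w)%:E)%E => // b _.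
case: (\int[P]_w (V w)%:E)%E => // v _.
case: (\int[P]_w (U w)%:E)%E => // u _.
by rewrite -!EFinM -!EFinD => -[h]; congr EFin; lra.
Qed.

Lemma integral_prod_indep_signed (I : finType) (X : I -> {RV P >-> R})
    (J1 J2 : {set I}) (U V : T -> R) :
  mutually_independent X -> {in J1, forall i, i \notin J2} ->
  measurable_fun setT (U : sigma_of X J1 -> R) ->
  measurable_fun setT (V : sigma_of X J2 -> R) ->
  P.-integrable setT (EFin \o U) -> P.-integrable setT (EFin \o V) ->
  P.-integrable setT (EFin \o (fun w => U w * V w)) ->
  (\int[P]_w (U w * V w)%:E = \int[P]_w (U w)%:E * \int[P]_w (V w)%:E)%E.
Proof.
move=> indepX J12 sU sV iU iV iUV.
have mU : measurable_fun setT U by apply/measurable_EFinP; case/integrableP: iU.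
have mV : measurable_fun setT V by apply/measurable_EFinP; case/integrableP: iV.
have abs_ge0 (u : R) : 0 <= `|u| + u.
  by have := ler_norm (- u); rewrite normrN; lra.
have sabs J (Z : T -> R) : measurable_fun setT (Z : sigma_of X J -> R) ->
    measurable_fun setT ((fun w => `|Z w|) : sigma_of X J -> R).
  by move=> sZ; exact: measurableT_comp.
have sabsD J (Z : T -> R) : measurable_fun setT (Z : sigma_of X J -> R) ->
    measurable_fun setT ((fun w => `|Z w| + Z w) : sigma_of X J -> R).
  by move=> sZ; apply: measurable_funD => //; exact: sabs.
have dominated (Z1 Z2 : T -> R) (c : R) : measurable_fun setT Z1 ->
    P.-integrable setT (EFin \o Z2) -> (forall w, `|Z1 w| <= c * `|Z2 w|) ->
    P.-integrable setT (EFin \o Z1).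
  move=> mZ1 iZ2 Z12.
  apply: (le_integrable measurableT _ _
    (integrableZl measurableT c (integrable_abse iZ2))) => //.
    exact/measurable_EFinP.
  move=> w _ /=; rewrite lee_fin normrM normr_id.
  by apply: le_trans (Z12 w) _; rewrite ler_wpM2r// ler_norm.
(* With a nonnegative first factor [S], splitting [V] leaves only nonnegative products, covered by
   [integral_prod_indep]. Splitting [U] then reduces the claim to [S = |U| + U] and [S = |U|]. *)
have half (S : T -> R) : (forall w, 0 <= S w) ->
    measurable_fun setT (S : sigma_of X J1 -> R) ->
    P.-integrable setT (EFin \o S) ->
    P.-integrable setT (EFin \o (fun w => S w * V w)) ->
    (\int[P]_w (S w * V w)%:E = \int[P]_w (S w)%:E * \int[P]_w (V w)%:E)%E.
  move=> S0 sS iS iSV; rewrite muleC.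
  under eq_integral do rewrite mulrC.
  apply: integral_prod_abs_split => //.
  - by under eq_fun do rewrite mulrC.
  - under eq_integral do rewrite mulrC.
    rewrite muleC; apply: (integral_prod_indep indepX J12) => //.
    exact: sabsD.
  - under eq_integral do rewrite mulrC.
    rewrite muleC; apply: (integral_prod_indep indepX J12) => //.
    exact: sabs.
apply: integral_prod_abs_split => //; apply: half => //.
- exact: sabsD.
- apply: (dominated _ U 2) => //.
    by apply: measurable_funD => //; exact: measurableT_comp.
  by move=> w; rewrite (le_trans (ler_normD _ _))// normr_id; lra.
- apply: (dominated _ (fun w => U w * V w) 2) => //.
    apply: measurable_funM => //; apply: measurable_funD => //.
    exact: measurableT_comp.
  move=> w; rewrite !normrM mulrA ler_wpM2r//.
  by rewrite (le_trans (ler_normD _ _))// normr_id; lra.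
- exact: sabs.
- apply: (dominated _ U 1) => [|//|w]; first exact: measurableT_comp.
  by rewrite normr_id mul1r.
- apply: (dominated _ (fun w => U w * V w) 1) => //.
    by apply: measurable_funM => //; exact: measurableT_comp.
  by move=> w; rewrite !normrM normr_id mul1r.
Qed.

Lemma union_bound (D : finType) (bad : D -> set T) (e : R) :
  (forall p, measurable (bad p)) -> (forall p, (P (bad p) <= e%:E)%E) ->
  exists G, [/\ measurable G, ((1 - #|D|%:R * e)%:E <= P G)%E &
    forall w, G w -> forall p, ~ bad p w].
Proof.
move=> mbad Pbad.
have [mU PU] : measurable (\big[setU/set0]_p bad p) /\
    (P (\big[setU/set0]_p bad p) <= (\sum_(p : D) e)%:E)%E.
  rewrite -sumEFin.
  apply: (big_ind2 (fun A (x : \bar R) => measurable A /\ (P A <= x)%E)) => //.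
    by split=> //; rewrite measure0.
  move=> A x B y [mA PA] [mB PB]; split; first exact: measurableU.
  by apply: (le_trans (measureU2 P mA mB)); exact: leeD.
exists (~` \big[setU/set0]_p bad p); split.
- exact: measurableC.
- rewrite probability_setC// EFinB leeB//.
  by move: PU; rewrite sumr_const mulr_natl.
- move=> w Gw p bw; apply: Gw.
  by rewrite (bigD1 p)//=; left.
Qed.

End signed_product.

(** * The good event *)

Lemma measurable_quantizer (R : realType) (delta : R) : 0 < delta ->
  measurable_fun setT (quantizer delta).
Proof.
move=> d0; apply: nondecreasing_measurable => // s t st.
rewrite /quantizer ler_pM2r// ler_int; apply: ceil_le.
by rewrite lerD2r ler_pM2r// invr_gt0.
Qed.

Section good_event.
Context {R : realType} (K : R) (K_gt0 : 0 < K).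

(** The rate of [subgaussian_exp_sqr]. *)
Definition exp_rate : R := (4 * expR 1 * K ^+ 2)^-1.

(* [2] bounds the exponential moment of the squared entries, and [expR exp_rate]
   that of the squared quantization errors in units of [delta], which are at
   most [1 / 2] in absolute value. *)
Definition moment_bound : R := 2 + expR exp_rate.

(** The denominator scale of [product_concentration] at the rate [exp_rate] and the moment bound
    [moment_bound]. *)
Definition tail_scale : R :=
  16 / exp_rate ^+ 2 * (expR moment_bound * moment_bound) + exp_rate^-1.

Lemma exp_rate_gt0 : 0 < exp_rate.
Proof. by rewrite invr_gt0 !mulr_gt0 ?expR_gt0 ?exprn_gt0. Qed.

Lemma moment_bound_ge0 : 0 <= moment_bound.
Proof. by rewrite addr_ge0 ?expR_ge0. Qed.

Lemma tail_scale_gt0 : 0 < tail_scale.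
Proof.
apply: ltr_wpDl; last by rewrite invr_gt0 exp_rate_gt0.
apply: mulr_ge0; first by rewrite divr_ge0 ?sqr_ge0.
by rewrite mulr_ge0 ?expR_ge0 ?moment_bound_ge0.
Qed.

Context (m N : nat) (d : measure_display) (Omega : measurableType d).
Context (P : probability Omega R) (Phi : 'I_m * 'I_N -> {RV P >-> R}).
Hypothesis indepPhi : mutually_independent Phi.
Hypothesis meanPhi : forall ij, ('E_P[Phi ij] = 0)%E.
Hypothesis varPhi : forall ij, ('V_P[Phi ij] = 1)%E.
Hypothesis psi2Phi : forall ij, (subgaussian_norm (Phi ij) <= K%:E)%E.

Lemma entry_exp_sqr ij :
  (\int[P]_w (expR (exp_rate * Phi ij w ^+ 2))%:E <= moment_bound%:E)%E.
Proof.
apply: le_trans (subgaussian_exp_sqr K_gt0 (psi2Phi ij)) _.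
by rewrite lee_fin lerDl expR_ge0.
Qed.

Lemma entry_prod_integrable ij kl :
  P.-integrable setT (EFin \o (fun w => Phi ij w * Phi kl w)).
Proof.
apply: (exp_moment_integrable (M := moment_bound) exp_rate_gt0).
  exact: measurable_funM.
exact: (exp_moment_prod (ltW exp_rate_gt0) _ _
  (entry_exp_sqr ij) (entry_exp_sqr kl)).
Qed.

Lemma entry_integrable ij : P.-integrable setT (EFin \o Phi ij).
Proof.
have i1 : P.-integrable setT (EFin \o cst (1 : R)).
  exact: finite_measure_integrable_cst.
apply: (le_integrable measurableT _ _
  (integrableD measurableT i1 (entry_prod_integrable ij ij))) => //.
  exact/measurable_EFinP.
move=> w _ /=; rewrite lee_fin -expr2 [leRHS]ger0_norm ?addr_ge0 ?sqr_ge0//.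
rewrite -real_normK ?num_real//.
by have := sqr_ge0 (`|Phi ij w| - 1); rewrite sqrrB; nra.
Qed.

(** This identifies the mean of the Gram matrix as [m] times the identity: the variance gives the
    diagonal, independence of distinct centered entries the rest. *)
Lemma entry_second_moment i j l :
  (\int[P]_w (Phi (i, j) w * Phi (i, l) w)%:E = (j == l)%:R%:E)%E.
Proof.
have [<-|jl] := eqVneq j l.
  have := varPhi (i, j); rewrite /variance covariance.unlock meanPhi /= unlock.
  move=> <-; apply: eq_integral => w _; rewrite -{1 2}[Phi _ w]subr0.
  by [].
have mean0 kl : (\int[P]_w (Phi kl w)%:E = 0)%E.
  by have := meanPhi kl; rewrite unlock.
rewrite (@integral_prod_indep_signed _ _ _ P _ Phi [set (i, j)]%SET
  [set (i, l)]%SET)//.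
- by rewrite mean0 mul0e.
- move=> ij; rewrite !inE => /eqP ->; by rewrite xpair_eqE eqxx.
- by apply: measurable_sigma_of; rewrite inE.
- by apply: measurable_sigma_of; rewrite inE.
- exact: entry_integrable.
- exact: entry_integrable.
- exact: entry_prod_integrable.
Qed.

Context (x : 'cV[R]_N) (delta : R) (delta_gt0 : 0 < delta).

Let u i w : R := \sum_l Phi (i, l) w * x l 0.

(** Dividing by [delta] makes the error at most [1 / 2], so its moment bound does not depend on
    [delta]. *)
Let residual i w : R := (u i w - quantizer delta (u i w)) / delta.

Let block_measurable_entry i j :
  block_measurable Phi fst i (Phi (i, j)).
Proof. exact: block_measurable_var. Qed.

Let block_measurable_residual i : block_measurable Phi fst i (residual i).
Proof.
have mu : block_measurable Phi fst i (u i).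
  apply: (@measurable_sum _ (sigma_of Phi (block_of fst [:: i]))) => l.
  by apply: measurable_funM => //; exact: block_measurable_entry.
apply: measurable_funM => //; apply: measurable_funB => //.
apply: (measurableT_comp (measurable_quantizer delta_gt0)); exact: mu.
Qed.

Let residual_exp_sqr i :
  (\int[P]_w (expR (exp_rate * residual i w ^+ 2))%:E <= moment_bound%:E)%E.
Proof.
apply: (@le_trans _ _ (\int[P]_w (cst (expR exp_rate)%:E) w)%E).
  apply: ge0_le_integral => //.
    apply/measurable_EFinP; apply: measurableT_comp => //.
    apply: measurable_funM => //; apply: measurable_funX.
    exact: block_measurableP (@block_measurable_residual i).
  move=> w _; rewrite /= lee_fin ler_expR -[leRHS]mulr1.
  rewrite ler_wpM2l ?(ltW exp_rate_gt0)//.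
  rewrite -real_normK ?num_real// exprn_ile1//.
  rewrite /residual normrM [X in _ * X]gtr0_norm ?invr_gt0//.
  rewrite ler_pdivrMr// mul1r (le_trans (quantizer_error _ delta_gt0))//.
  by move: delta_gt0; lra.
rewrite integral_cst//= probability_setT mule1 lee_fin.
by rewrite lerDr.
Qed.

Let E w : 'M[R]_(m, #|supp x|) := subcols (supp x) (random_matrix Phi w).
Let xT : 'cV[R]_#|supp x| := subentries (supp x) x.
Let v w := (E w)^T *m (E w *m xT - msq delta (E w *m xT)).

Let vE j w : v w j 0 =
  \sum_i delta * (Phi (i, enum_val j) w * residual i w).
Proof.
rewrite /v mulmx_subcols// mxE; apply: eq_bigr => i _.
rewrite !mxE (_ : \sum_l _ = u i w); last first.
  by apply: eq_bigr => l _; rewrite mxE.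
by rewrite /residual; field; rewrite gt_eqF.
Qed.

(** A union bound over [N * N.+1] deviations, [N * N] for the Gram entries and [N] for the
    correlations of columns with the quantization error. Entrywise control of [v] costs the factor
    [Num.sqrt #|supp x|%:R] in Euclidean norm. *)
Lemma good_event (t1 t2 e : R) : 0 < t1 -> t1 <= 1 -> 0 < t2 -> t2 <= 1 ->
  (forall t, t \in [:: t1; t2] ->
     2 * expR (- (m%:R * t ^+ 2 / (4 * tail_scale))) <= e) ->
  exists G : set Omega,
    [/\ measurable G, ((1 - (N * N.+1)%:R * e)%:E <= P G)%E &
      forall w, G w ->
        (forall j l, `|gram (random_matrix Phi w) j l - m%:R * (j == l)%:R|
           <= m%:R * t1) /\
        norm2 (v w - expectation_cV P v) <=
          Num.sqrt #|supp x|%:R * (m%:R * t2 * delta)].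
Proof.
move=> t10 t11 t20 t21 te.
(* [(j, Some l)] indexes the Gram entry of the columns [j] and [l], and
   [(j, None)] the [j]-th entry of [Phi^T (u - q u) / delta]. *)
pose V (o : option 'I_N) i w :=
  if o is Some l then Phi (i, l) w else residual i w.
pose t (o : option 'I_N) := if o is Some _ then t1 else t2.
pose dev (p : 'I_N * option 'I_N) w := \sum_i (Phi (i, p.1) w * V p.2 i w -
  fine (\int[P]_w' (Phi (i, p.1) w' * V p.2 i w')%:E)).
pose bad p := [set w | m%:R * t p.2 <= `|dev p w|].
have mV o i : block_measurable Phi fst i (V o i).
  case: o => [l|]; first exact: block_measurable_entry.
  exact: block_measurable_residual.
have t0 o : 0 < t o by case: o.
have t1' o : t o <= 1 by case: o.
have VM o i :
    (\int[P]_w (expR (exp_rate * V o i w ^+ 2))%:E <= moment_bound%:E)%E.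
  by case: o => [l|]; [exact: entry_exp_sqr|exact: residual_exp_sqr].
have Pbad p : (P (bad p) <= e%:E)%E.
  have := @product_concentration _ _ _ P _ _ Phi fst indepPhi
    (fun i => Phi (i, p.1)) (V p.2) exp_rate moment_bound (t p.2)
    exp_rate_gt0 moment_bound_ge0 (fun i => @block_measurable_entry i p.1)
    (mV p.2) (fun i => entry_exp_sqr (i, p.1)) (VM p.2) (t0 _) (t1' _).
  rewrite card_ord => /le_trans; apply; rewrite lee_fin; apply: te.
  by rewrite /t; case: p.2 => [l|]; rewrite !inE eqxx ?orbT.
have mbad p : measurable (bad p).
  rewrite -[X in measurable X]setTI.
  apply: (measurable_fun_le measurableT (measurable_cst _)).
  apply: measurableT_comp => //; apply: measurable_sum => i.
  apply: measurable_funB => //; apply: measurable_funM => //.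
  exact: block_measurableP (mV _ _).
have [G [mG PG Gbad]] := union_bound mbad Pbad.
exists G; split=> //.
  by move: PG; rewrite card_prod card_option !card_ord.
move=> w Gw; split=> [j l|].
  have /negP := Gbad w Gw (j, Some l); rewrite -ltNge => /ltW.
  have -> : gram (random_matrix Phi w) j l =
      \sum_i Phi (i, j) w * Phi (i, l) w.
    by apply: eq_bigr => i _; rewrite !mxE.
  rewrite /dev /= sumrB.
  under [X in _ - X]eq_bigr do rewrite entry_second_moment.
  by rewrite /= sumr_const card_ord -[_ *+ m]mulr_natl.
have iY j i :
    P.-integrable setT (EFin \o (fun w => Phi (i, j) w * residual i w)).
  apply: (exp_moment_integrable (M := moment_bound) exp_rate_gt0).
    apply: measurable_funM => //.
    exact: block_measurableP (@block_measurable_residual i).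
  apply: (exp_moment_prod (ltW exp_rate_gt0)) => //.
  - exact: block_measurableP (@block_measurable_residual i).
  - exact: entry_exp_sqr.
apply: norm2_le_card => [|j]; first by rewrite !mulr_ge0// ltW.
have /negP := Gbad w Gw (enum_val j, None); rewrite -ltNge => /ltW.
rewrite /dev /= => dev_le; rewrite mxE [X in _ + X]mxE [X in _ - X]mxE.
(* By linearity the mean of [v] is [delta] times the sum of the centering constants in [dev]. *)
have -> : ('E_P[(fun w' => v w' j 0)%R] = (\sum_i delta *
    fine (\int[P]_w' (Phi (i, enum_val j) w' * residual i w')%:E))%:E)%E.
  rewrite unlock; under eq_integral do rewrite vE -sumEFin.
  rewrite integral_sum//; last first.
    by move=> i; exact: (integrableZl measurableT delta (iY _ i)).
  rewrite -sumEFin; apply: eq_bigr => i _.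
  rewrite EFinM fineK; last exact: (integrable_fin_num measurableT (iY _ i)).
  by rewrite -(integralZl measurableT (iY _ i)).
rewrite /= vE -sumrB.
under eq_bigr do rewrite -mulrBr.
rewrite -mulr_sumr normrM (gtr0_norm delta_gt0) mulrC.
by rewrite ler_wpM2r// ltW.
Qed.

End good_event.

(** * Explicit constants and the final reconstruction bound *)

Unset Implicit Arguments.

Theorem theorem4p1 (R : realType) (K : R) (hK : 0 < K) :
  exists2 cK : R, 0 < cK &
  forall k : nat, (3 <= k)%N ->
  exists (C : R) (c4 : R -> R),
    [/\ 0 < C,
        (forall alpha : R, 0 <= alpha < 2^-1 -> 0 < c4 alpha) &
  forall (N : nat) (x : 'cV[R]_N), #|supp x| = k ->
  exists c5 c6 c7 : R,
    [/\ 0 < c5, 0 < c6, 0 < c7 &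
  forall (alpha delta : R) (m : nat)
    (d : measure_display) (Omega : measurableType d) (P : probability Omega R)
    (Phi : 'I_m * 'I_N -> {RV P >-> R})
    (xMSQ : Omega -> 'cV[R]_N),
  let lambda : R := m%:R / k%:R in
  let A : R := (2^-1 - cK * lambda `^ (- 2^-1)) ^- 2 in
  let PhiM : Omega -> 'M[R]_(m, N) := random_matrix Phi in
  let E : Omega -> 'M[R]_(m, #|supp x|) :=
    fun w => subcols (supp x) (PhiM w) in
  let xT : 'cV[R]_#|supp x| := subentries (supp x) x in
  0 <= alpha < 2^-1 ->
  0 < delta ->
  (forall j : 'I_N, j \in supp x -> C * delta <= `|x j 0|) ->
  mutually_independent Phi ->
  identically_distributed Phi ->
  (forall ij, ('E_P[Phi ij] = 0)%E) ->
  (forall ij, ('V_P[Phi ij] = 1)%E) ->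
  (forall ij, (subgaussian_norm (Phi ij) <= K%:E)%E) ->
  c4 alpha * ln N%:R <= lambda ->
  (forall w, two_stage delta k (PhiM w) (msq delta (PhiM w *m x)) (xMSQ w)) ->
  exists G : set Omega,
    [/\ measurable G,
        ((1 - c5 * expR (- c6 * lambda `^ alpha))%:E <= P G)%E &
        forall w, G w ->
          norm2 (xMSQ w - x) <=
          A * (m%:R^-1 *
                 norm2 (expectation_cV P
                   (fun w => (E w)^T *m (E w *m xT - msq delta (E w *m xT))))
               + c7 * Num.sqrt (ln k%:R)
                 * lambda `^ (- ((1 - alpha) / 2)) * delta)]]].
Proof.
set B := tail_scale K.
have B0 : 0 < B by exact: tail_scale_gt0.
exists 1 => // k k3.
have k0 : 0 < k%:R :> R by rewrite ltr0n (leq_trans _ k3).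
have k1 : 1 <= k%:R :> R by rewrite ler1n (leq_trans _ k3).
have ln3 : 0 < ln 3 :> R by rewrite ln_gt0// ltr1n.
have lnk : 0 < ln k%:R :> R by rewrite ln_gt0// ltr1n (leq_trans _ k3).
(* Since [N >= k >= 3], this [c4] forces [lambda >= 16], whatever [alpha] is. *)
exists 3, (fun=> 16 / ln 3); split=> // [_ _|]; first by rewrite divr_gt0.
move=> N x suppx.
have N3 : (3 <= N)%N.
  by rewrite (leq_trans k3)// -suppx -[leqRHS]card_ord max_card.
(* [c5] counts the two-sided tails of the union bound. [c6] is the exponent [m * t ^+ 2 / (4 * B)]
   at [m = k * lambda] and [t = 1 / (8 k)], divided by [lambda]. [c7] trades [Num.sqrt (ln k%:R)]
   for the [Num.sqrt k%:R] of [good_event]. *)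
exists ((N * N.+1)%:R * 2), (256 * k%:R * B)^-1,
  (Num.sqrt k%:R / Num.sqrt (ln k%:R)); split.
- by rewrite mulr_gt0// ltr0n muln_gt0 (leq_trans _ N3).
- by rewrite invr_gt0 !mulr_gt0.
- by rewrite divr_gt0// sqrtr_gt0.
move=> alpha delta m d Omega P Phi xMSQ lambda A PhiM E xT.
move=> /andP[alpha0 alpha1] delta0 x_large indepPhi _ meanPhi varPhi psi2Phi.
move=> lambda_large reconstruction.
have l16 : 16 <= lambda.
  apply: le_trans lambda_large; rewrite -mulrA ler_peMr// mulrC.
  rewrite ler_pdivlMr// mul1r.
  by rewrite ler_ln// ?posrE ?ltr0n ?ler_nat ?(leq_trans _ N3).
have l1 : 1 <= lambda by apply: le_trans l16; rewrite ler1n.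
have l0 : 0 < lambda by exact: lt_le_trans l1.
have mE : m%:R = k%:R * lambda.
  by rewrite /lambda mulrC divfK// gt_eqF.
have m0 : 0 < m%:R :> R by rewrite mE mulr_gt0.
have A4 : 4 <= A.
  have -> : A = ((2^-1 - lambda `^ (- 2^-1)) ^+ 2)^-1 by rewrite /A mul1r.
  have s4 : lambda `^ (- 2^-1) <= 4^-1.
    rewrite powRN powR12_sqrt ?(ltW l0)// lef_pV2 ?posrE ?sqrtr_gt0//.
    rewrite -[4]ger0_norm// -sqrtr_sqr ler_sqrt; last exact: ltW.
    by apply: le_trans l16; rewrite expr2; lra.
  have s0 : 0 <= lambda `^ (- 2^-1) by exact: powR_ge0.
  have g0 : 0 < 2^-1 - lambda `^ (- 2^-1) by lra.
  rewrite -[leLHS]invrK lef_pV2 ?posrE ?invr_gt0 ?exprn_gt0//.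
  by rewrite expr2; nra.
(* [t1] is the coherence threshold of the deterministic part, and [t2] the decay rate of the claimed
   error. *)
pose t1 : R := (8 * k%:R)^-1.
pose t2 : R := lambda `^ (- ((1 - alpha) / 2)).
have t10 : 0 < t1 by rewrite invr_gt0 mulr_gt0.
have t11 : t1 <= 1 by rewrite invf_le1 ?mulr_gt0//; lra.
have t20 : 0 < t2 by rewrite powR_gt0.
have t21 : t2 <= 1.
  by rewrite -(powRr0 lambda) ler_powR//; lra.
pose e : R := 2 * expR (- (256 * k%:R * B)^-1 * lambda `^ alpha).
have te t : t \in [:: t1; t2] ->
    2 * expR (- (m%:R * t ^+ 2 / (4 * tail_scale K))) <= e.
  move=> tt; rewrite ler_pM2l// ler_expR mulNr lerN2 -/B.
  suff lam_le : lambda `^ alpha <= 64 * k%:R ^+ 2 * lambda * t ^+ 2.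
    rewrite mulrC ler_pdivrMr ?mulr_gt0// mE.
    apply: le_trans lam_le _; rewrite le_eqVlt; apply/orP; left; apply/eqP.
    by field; rewrite gt_eqF.
  move: tt; rewrite !inE => /orP[|] /eqP ->.
    have -> : 64 * k%:R ^+ 2 * lambda * t1 ^+ 2 = lambda.
      by rewrite /t1; field; rewrite gt_eqF.
    by rewrite -{2}(powRr1 (ltW l0)) ler_powR//; lra.
  have -> : t2 ^+ 2 = lambda `^ (alpha - 1).
    rewrite /t2 -powR_mulrn ?powR_ge0// -powRrM; congr (_ `^ _).
    by field.
  have -> : lambda `^ alpha = lambda * lambda `^ (alpha - 1).
    rewrite -{2}(powRr1 (ltW l0)) -powRD; last by rewrite (gt_eqF l0) implybT.
    by congr (_ `^ _); ring.
  rewrite -mulrA ler_peMl ?mulr_ge0 ?powR_ge0 ?(ltW l0)//.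
  by rewrite expr2; nra.
have [G [mG PG Gp]] := good_event hK indepPhi meanPhi varPhi psi2Phi x delta0
  t10 t11 t20 t21 te.
exists G; split=> //.
  by move: PG; rewrite /e mulrA.
move=> w Gw; have [coh conc] := Gp w Gw.
have m_gt0 : (0 < m)%N by rewrite -(ltr0n R).
have card0 : (0 < #|supp x|)%N by rewrite suppx (leq_trans _ k3).
have coh' j l : `|gram (PhiM w) j l - m%:R * (j == l)%:R| <=
    m%:R / (8 * #|supp x|%:R) by rewrite suppx; exact: coh.
have rec : two_stage delta #|supp x| (PhiM w) (msq delta (PhiM w *m x))
    (xMSQ w).
  by rewrite suppx; exact: reconstruction.
have := two_stage_error delta0 m_gt0 card0 coh' x_large rec.
rewrite -(mulmx_subcols (PhiM w) (fintype.subxx _)) -/xT -/(E w) => err.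
set EV := expectation_cV _ _.
set V := _ *m _ in err.
have VEV : norm2 V <= norm2 EV + Num.sqrt k%:R * (m%:R * t2 * delta).
  rewrite -[V](subrK EV) addrC; apply: le_trans (norm2D _ _) _.
  by rewrite lerD2l -[in leRHS]suppx; exact: conc.
apply: (le_trans err).
have -> : Num.sqrt k%:R / Num.sqrt (ln k%:R) * Num.sqrt (ln k%:R) =
    Num.sqrt k%:R :> R by rewrite divfK// gt_eqF// sqrtr_gt0.
apply: (@le_trans _ _ (2 / m%:R *
    (norm2 EV + Num.sqrt k%:R * (m%:R * t2 * delta)))).
  by rewrite ler_pM2l// divr_gt0.
have -> : 2 / m%:R * (norm2 EV + Num.sqrt k%:R * (m%:R * t2 * delta)) =
    2 * (m%:R^-1 * norm2 EV + Num.sqrt k%:R * t2 * delta).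
  by field; rewrite gt_eqF.
(* The deterministic factor 2 is absorbed by [A >= 4]. *)
rewrite ler_wpM2r//; last by apply: le_trans A4; rewrite ler_nat.
rewrite addr_ge0 ?mulr_ge0 ?invr_ge0 ?norm2_ge0 ?sqrtr_ge0//; exact: ltW.
Qed.
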